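(* Let $(\nu_j)_{j\in \mathbb N}$ be an equidistributed averaging sequence of probability measures on $\mathbb Z$, and let $A,B\subset \mathbb Z$ with $d_\nu(A)>0$ and $d^*(B)>0$. Then for all $k\in\mathbb N$ and all $\varepsilon>0$, there exists $d\in\mathbb N$ such that $$d^*\Bigl(\bigcap_{l=0}^k\bigl((A+B)-ld\bigr)\Bigr)>\max\{d_\nu(A),d^*(B)\}-\varepsilon.$$ In fact, for all such $k$ and $\varepsilon$ there is a Bohr set of $d$ (that is, a Bohr set $D\subset\mathbb Z$ all of whose elements $d$) satisfying this inequality.
   Context: $\mathbb N$ is the set of positive integers; $A+B:=\{a+b:a\in A,b\in B\}$ and $S-c:=\{s-c:s\in S\}$. The upper Banach density of $B\subset\mathbb Z$ is $d^*(B):=\lim_{M\to\infty}\sup_{N\in\mathbb Z}\frac{|B\cap[N,N+M-1]|}{M}$. A sequence $(\nu_j)_{j\in\mathbb N}$ of probability measures on $\mathbb Z$ is an equidistributed averaging sequence if for all $\theta\in(0,2\pi)$, $\lim_{j\to\infty}\int e^{in\theta}\,d\nu_j(n)=0$. For such a sequence and $A\subset\mathbb Z$, $d_\nu(A):=\limsup_{j\to\infty}\nu_j(A)$. A set $S\subset\mathbb Z$ is Bohr if there is a trigonometric polynomial $P(n)=\sum_{j=1}^k c_je^{i\lambda_jn}$ ($c_j\in\mathbb C$, $\lambda_j\in\mathbb R$) such that $\{n\in\mathbb Z:\operatorname{Re}P(n)>0\}$ is nonempty and contained in $S$. *)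

(* Defs.v *)
From HB Require Import structures.
From mathcomp Require Export all_boot all_order all_algebra.
From mathcomp Require Export all_classical all_reals all_analysis.
From mathcomp Require Export finmap complex.
Set Implicit Arguments.
Unset Strict Implicit.
Unset Printing Implicit Defensive.
Export Order.TTheory GRing.Theory Num.Theory.
Export numFieldNormedType.Exports.
#[global] Open Scope classical_set_scope.
#[global] Open Scope ring_scope.
#[global] Open Scope complex_scope.

(* Every subset of int is measurable, so that [probability int R] is the type
   of all probability measures on the integers. *)
HB.instance Definition _ := isPointed.Build int 0.
HB.instance Definition _ := @isMeasurable.Build default_measure_display
  int discrete_measurable discrete_measurable0
  discrete_measurableC discrete_measurableU.

Definition sumset (A B : set int) : set int := [set a + b | a in A & b in B].

Definition shift_left (S : set int) (c : int) : set int := [set s - c | s in S].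

Section Definitions.
Variable R : realType.

(* The limit in M exists by subadditivity (Fekete); the value at M = 0 is 0 / 0 = 0
   and is irrelevant to it. *)
Definition upper_banach_density (B : set int) : R :=
  limn (fun M : nat =>
    sup [set (#|` fset_set (B `&` `[N, N + M%:Z - 1])|)%:R / M%:R
        | N in [set: int]] : R).

(* e^(i t) *)
Definition expi (t : R) : R[i] := cos t +i* sin t.

Definition cintegral (mu : probability int R) (f : int -> R[i]) : R[i] :=
  (\int[mu]_n complex.Re (f n)) +i* (\int[mu]_n complex.Im (f n)).

(* [R[i]^o] only selects the topology of the norm `|z| on the complex numbers. *)
Definition equidistributed (nu : nat -> probability int R) : Prop :=
  forall theta : R, 0 < theta < 2 * pi ->
    (fun j => cintegral (nu j) (fun n => expi (n%:~R * theta)) : R[i]^o) @ \oo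
      --> (0 : R[i]^o).

Definition upper_density (nu : nat -> probability int R) (A : set int) : R :=
  limn_sup (fun j => fine (nu j A)).

Definition trig_poly (m : nat) (c : 'I_m -> R[i]) (lam : 'I_m -> R) (n : int) :
    R[i] :=
  \sum_(j < m) c j * expi (lam j * n%:~R).

Definition is_bohr (S : set int) : Prop :=
  exists (m : nat) (c : 'I_m -> R[i]) (lam : 'I_m -> R),
    [set n | 0 < complex.Re (trig_poly c lam n)] !=set0 /\
    [set n | 0 < complex.Re (trig_poly c lam n)] `<=` S.

End Definitions.

(* Main.v *)
(* The density of [B] is realised by a translation-invariant mean [L], an
   ultralimit of averages over windows in which [B] has nearly maximal density.
   The correlations [L (1_B * 1_B (. + n))] are positive definite, hence by
   Herglotz the Fourier coefficients of a measure on the circle, written here as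
   the law of a monotone function [G] of a uniform variable in [0, 1].
   Let [w] be a finite truncation of [nu j] and [a] its restriction to [A]. The
   convolution of [a] with [1_B] is positive only on [A + B], and by the ergodic
   theorem along [w] it exceeds a fixed threshold on a set of density close to
   the maximum of the two densities. For large [j] the Fourier transform of [a]
   is small in L^2 on the nonatomic part of the spectral measure, so only
   finitely many frequencies matter, and translating the convolution by an
   element of a Bohr neighbourhood of 0 for them barely changes it in L^2.
   Ergodicity is not needed: the atom of the spectral measure at 0 is controlled
   because no window carries more than the upper Banach density of [B]. *)
Require Import Defs.
From mathcomp Require Import zify ring lra measurable_realfun.
Set Implicit Arguments.
Unset Strict Implicit.
Unset Printing Implicit Defensive.

(** * Bounded functions and ultralimits *)

(** At a single frequency the restriction of an equidistributed weight to an arbitrary [A] can keep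
    a large Fourier transform; only its mean square off finitely many frequencies is controlled.
    This forces Bohr neighbourhoods, and it is why smallness is proved for all sub-weights at once.
    The maximum comes from two upper bounds on the same convolution [f], whose mean is [a * beta]
    with [a] the mass that the truncation gives to [A]. Since [f <= a], its superlevel set has mean
    almost [beta]; since [f] is also below the convolution with the whole weight, which is close to
    [beta] in mean square, the same set has mean almost [a]. The passage to [A + B] is a Chebyshev
    argument: where [f] exceeds the threshold at [x] and vanishes at [x + l * d], translation has
    moved [f] by more than the threshold. Monotone functions stand in for measures because a
    pointwise ultralimit of monotone functions is monotone, hence measurable, and because an atom is
    an interval of constancy, which sampling at regularly spaced points detects when it is long. *)

Definition bdd {T : Type} {R : realType} (f : T -> R) := exists C : R, forall x, `|f x| <= C.

Lemma bddD {T : Type} {R : realType} (f g : T -> R) :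
  bdd f -> bdd g -> bdd (fun x => f x + g x).
Proof.
move=> [C hC] [D hD]; exists (C + D) => x.
by rewrite (le_trans (ler_normD _ _))// lerD.
Qed.

Lemma bddB {T : Type} {R : realType} (f g : T -> R) :
  bdd f -> bdd g -> bdd (fun x => f x - g x).
Proof.
move=> [C hC] [D hD]; exists (C + D) => x.
by rewrite (le_trans (ler_normB _ _))// lerD.
Qed.

Lemma bddM {T : Type} {R : realType} (f g : T -> R) :
  bdd f -> bdd g -> bdd (fun x => f x * g x).
Proof.
move=> [C hC] [D hD]; exists (C * D) => x.
by rewrite normrM ler_pM.
Qed.

Lemma bdd_sqr {T : Type} {R : realType} (f : T -> R) : bdd f -> bdd (fun x => f x ^+ 2).
Proof. by move=> bf; under eq_fun do rewrite expr2; exact: bddM. Qed.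

Lemma bdd_indic {T : Type} {R : realType} (E : set T) : bdd (\1_E : T -> R).
Proof. by exists 1 => x; rewrite indicE ger0_norm// lern1 leq_b1. Qed.

Lemma bdd_cst {T : Type} {R : realType} (c : R) : bdd (fun _ : T => c).
Proof. by exists `|c|. Qed.

Lemma bdd_comp {S T : Type} {R : realType} (f : T -> R) (g : S -> T) :
  bdd f -> bdd (fun x => f (g x)).
Proof. by move=> [C hC]; exists C => x. Qed.

Lemma bdd_sum {T : Type} {R : realType} (I : Type) (r : seq I) (f : I -> T -> R) :
  (forall i, bdd (f i)) -> bdd (fun x => \sum_(i <- r) f i x).
Proof.
move=> h; elim: r => [|i r IH].
  by exists 0 => x; rewrite big_nil normr0.
have [C hC] := bddD (h i) IH.
by exists C => x; rewrite big_cons.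
Qed.

Section Ultralimit.
Context {R : realType} {U : set_system nat} {UU : UltraFilter U}.

Lemma fmap_ultra (T : Type) (u : nat -> T) : UltraFilter (fmap u U).
Proof.
split; first exact: fmap_proper_filter.
move=> G GP sG; apply/seteqP; split => //= A GA.
case: (in_ultra_setVsetC (u @^-1` A) UU) => //= h.
have GnA : G (~` A) by apply: sG.
have : G (A `&` ~` A) by apply: filterI.
by rewrite setICr => h0; case: (@filter_not_empty _ G _ h0).
Qed.

Lemma ultra_cvg (u : nat -> R) : bdd u -> u @ U --> lim (u @ U).
Proof.
move=> [C hC]; have := @segment_compact R (- C) C.
rewrite compact_ultra => /(_ (u @ U) (fmap_ultra u)).
have h : (u @ U) `[- C, C]%classic.
  by apply: (@nearW _ U) => x; rewrite /= in_itv /= -ler_norml.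
move=> /(_ h) [l [_ ul]]; exact: (cvgP l ul).
Qed.

End Ultralimit.

Lemma cvg_sumr {R : realType} {T I : Type} (F : set_system T) {FF : Filter F}
    (r : seq I) (u : I -> T -> R) (l : I -> R) :
  (forall i, u i @ F --> l i) ->
  (fun x => \sum_(i <- r) u i x) @ F --> \sum_(i <- r) l i.
Proof.
move=> h; elim: r => [|i r IH].
  by under eq_fun do rewrite big_nil; rewrite big_nil; exact: cvg_cst.
under eq_fun do rewrite big_cons; rewrite big_cons.
exact: (cvgD (h i) IH).
Qed.

Lemma nat_ultrafilter : exists U : set_system nat, UltraFilter U /\ \oo `<=` U.
Proof. exact: ultraFilterLemma. Qed.

(** The limit is the infimum over [n > 0]: if [h] nearly attains it, writing [n = q * h + r] with
    [r < h] bounds [s n / n] by [s h / h] plus a term of order [1 / n]. *)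
Lemma fekete {R : realType} (s : nat -> R) :
  (forall m n, s (m + n)%N <= s m + s n) -> (forall n, 0 <= s n) ->
  cvgn (fun n => s n / n%:R).
Proof.
move=> sD s0.
pose S := [set s n / n%:R | n in [set n | (0 < n)%N]].
have Slb : has_lbound S.
  by exists 0 => _ [n _ <-]; rewrite divr_ge0.
have Sne : S !=set0 by exists (s 1%N / 1%:R), 1%N.
(* The term [s 0] stays because subadditivity does not force it to vanish. *)
have smul q h r : s (q * h + r)%N <= q%:R * s h + r%:R * s 1%N + s 0%N.
  have e q' h' : s (q' * h')%N <= q'%:R * s h' + s 0%N.
    elim: q' => [|q' IH]; first by rewrite mul0n mul0r add0r.
    rewrite mulSn; apply: (le_trans (sD _ _)).
    by rewrite -natr1 mulrDl mul1r; lra.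
  elim: r => [|r IH]; first by rewrite addn0 mul0r addr0 e.
  by rewrite addnS -addn1; apply: (le_trans (sD _ _)); rewrite -natr1 mulrDl mul1r; lra.
apply/cvg_ex; exists (inf S); apply/cvgrPdist_le => e e0.
  have [_ [h h0 <-] hlt] : exists2 y, S y & y < inf S + e / 2.
    by apply: inf_lt => //; rewrite ltrDl divr_gt0.
  pose C := h%:R * s 1%N + s 0%N.
  near=> n.
  have n0 : (0 < n)%N by near: n; exact: nbhs_infty_gt.
  have n0' : (0 : R) < n%:R by rewrite ltr0n.
  have lo : inf S <= s n / n%:R by apply: ge_inf => //; exists n.
  rewrite ler_distlC.
  apply/andP; split; first by lra.
  have Cn : C <= n%:R * (e / 2).
    have : C / (e / 2) <= n%:R by near: n; apply: nbhs_infty_ger.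
    by rewrite ler_pdivrMr// divr_gt0.
  rewrite ler_pdivrMr//.
  have h0' : (0 : R) < h%:R by rewrite ltr0n.
  have := smul (n %/ h)%N h (n %% h)%N; rewrite -divn_eq => sn.
  have r1 : (n %% h)%N%:R * s 1%N <= h%:R * s 1%N.
    by rewrite ler_wpM2r// ler_nat ltnW// ltn_pmod.
  have q1 : (n %/ h)%N%:R * s h <= n%:R * (s h / h%:R).
    rewrite mulrCA mulrC ler_wpM2l// ler_pdivlMr// -natrM ler_nat.
    exact: leq_divM.
  have q2 : n%:R * (s h / h%:R) <= n%:R * (inf S + e / 2).
    by rewrite ler_wpM2l// ltW.
  rewrite /C in Cn; lra.
Unshelve. all: by end_near. Qed.

(** * Upper Banach density and invariant means *)

Section BanachDensity.
Context {R : realType}.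
Implicit Types (B E : set int) (f g : int -> R).

Definition window f (x : int) (M : nat) : R := \sum_(i < M) f (x + i%:Z).

(** Finiteness is carried through the induction because [fset_set] is meaningful on finite sets
    only; each step adds the right endpoint. *)
Lemma window_card B N M :
  finite_set (B `&` `[N, N + M%:Z - 1]) /\
  (#|` fset_set (B `&` `[N, N + M%:Z - 1])|)%:R = window \1_B N M.
Proof.
rewrite /window; elim: M => [|M [fM IH]].
  have -> : B `&` `[N, N + 0%:Z - 1] = set0.
    by apply/seteqP; split => x //= [_]; rewrite in_itv /=; lia.
  by split => //; rewrite fset_set0 big_ord0.
have -> : B `&` `[N, N + M.+1%:Z - 1] =
    (B `&` `[N, N + M%:Z - 1]) `|` (B `&` [set N + M%:Z]).
  rewrite -setIUr; congr (_ `&` _); apply/seteqP; split => x /=; rewrite !in_itv /=.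
    move=> h; case: (eqVneq x (N + M%:Z)) => [->|ne]; first by right.
    by left; lia.
  by case => [|->]; lia.
have f1 : finite_set (B `&` [set N + M%:Z]) by apply: finite_setIr.
split; first by rewrite finite_setU.
rewrite fset_setU// cardfsU.
have -> : (fset_set (B `&` `[N, (N + M%:Z - 1)%R]) `&` fset_set (B `&` [set (N + M%:Z)%R]))%fset = fset0.
  rewrite -fset_setI//; apply/eqP; rewrite -cardfs_eq0 cardfs_eq0; apply/eqP.
  apply/fsetP => x; rewrite in_fset0; apply/negP.
  rewrite in_fset_set; last exact: finite_setIl.
  by move=> /set_mem /= [[_]]; rewrite in_itv /= => h [_ e]; rewrite e in h; lia.
rewrite cardfs0 subn0 natrD IH big_ord_recr /=; congr (_ + _).
rewrite indicE; case: (pselect (B (N + M%:Z))) => h.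
  rewrite mem_set//.
  have -> : B `&` [set N + M%:Z] = [set N + M%:Z] by apply: setIidr => _ ->.
  by rewrite fset_set1 cardfs1.
rewrite memNset//.
have -> : B `&` [set N + M%:Z] = set0.
  by apply/seteqP; split => x //= [Bx e]; rewrite e in Bx.
by rewrite fset_set0 cardfs0.
Qed.

Definition max_window B (M : nat) : R := sup [set window \1_B N M | N in [set: int]].

Lemma window_indic_ge0 B N M : 0 <= window \1_B N M.
Proof. by apply: sumr_ge0 => i _; rewrite indicE. Qed.

Lemma window_indic_le B N M : window \1_B N M <= M%:R.
Proof.
rewrite -[M in leRHS]card_ord -sumr_const.
by apply: ler_sum => i _; rewrite indicE lern1 leq_b1.
Qed.

Lemma window_le_max B N M : window \1_B N M <= max_window B M.
Proof.
apply: ub_le_sup; last by exists N.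
by exists M%:R => _ [n _ <-]; exact: window_indic_le.
Qed.

Lemma max_window_attained B M e : 0 < e ->
  exists N, max_window B M - e < window \1_B N M.
Proof.
move=> e0.
have [|_ [N _ <-] h] := @sup_adherent _ [set window \1_B N M | N in [set: int]] _ e0.
  split; first by exists (window \1_B 0 M), 0.
  by exists M%:R => _ [n _ <-]; exact: window_indic_le.
by exists N.
Qed.

Lemma windowD f N m n : window f N (m + n) = window f N m + window f (N + m%:Z) n.
Proof.
rewrite /window big_split_ord /=; congr (_ + _).
by apply: eq_bigr => i _; rewrite PoszD addrA.
Qed.

Lemma max_windowD B m n : max_window B (m + n) <= max_window B m + max_window B n.
Proof.
apply: ge_sup; first by exists (window \1_B 0 (m + n)), 0.
by move=> _ [N _ <-]; rewrite windowD lerD// window_le_max.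
Qed.

Lemma max_window_ge0 B M : 0 <= max_window B M.
Proof. exact: le_trans (window_indic_ge0 B 0 M) (window_le_max _ _ _). Qed.

Lemma upper_banach_densityE B :
  upper_banach_density R B = limn (fun M => max_window B M / M%:R).
Proof.
rewrite /upper_banach_density; congr (lim (_ @ \oo)); apply/funext => M.
have [->|M0] := posnP M.
  rewrite invr0 mulr0; apply/eqP; rewrite eq_le; apply/andP; split.
    by apply: ge_sup => [|_ [N _ <-]]; [exists (0 : R), 0; rewrite ?mulr0|rewrite mulr0].
  apply: ub_le_sup; first by exists 0 => _ [N _ <-]; rewrite mulr0.
  by exists 0; rewrite ?mulr0.
have M0' : (0 : R) < M%:R by rewrite ltr0n.
apply/eqP; rewrite eq_le; apply/andP; split.
  apply: ge_sup; first by eexists; exists 0.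
  by move=> _ [N _ <-]; rewrite (window_card B N M).2 ler_pM2r ?invr_gt0// window_le_max.
rewrite ler_pdivrMr//; apply: ge_sup; first by exists (window \1_B 0 M), 0.
move=> _ [N _ <-]; rewrite -ler_pdivrMr//; apply: ub_le_sup; last first.
  by exists N => //; rewrite (window_card B N M).2.
exists 1 => _ [n _ <-]; rewrite (window_card B n M).2 ler_pdivrMr// mul1r.
exact: window_indic_le.
Qed.

Lemma cvg_max_window B :
  (fun M => max_window B M / M%:R) @ \oo --> upper_banach_density R B.
Proof.
rewrite upper_banach_densityE.
exact: fekete (@max_windowD B) (max_window_ge0 B).
Qed.

End BanachDensity.

Section InvariantMean.
Context {R : realType}.

(** The laws are restricted to bounded functions, where the ultralimits that produce a mean
    exist. *)
Record is_mean (L : (int -> R) -> R) : Prop := IsMean {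
  meanD : forall f g, bdd f -> bdd g -> L (fun x => f x + g x) = L f + L g;
  meanZ : forall c f, bdd f -> L (fun x => c * f x) = c * L f;
  mean_cst : forall c, L (fun=> c) = c;
  le_mean : forall f g, bdd f -> bdd g -> (forall x, f x <= g x) -> L f <= L g;
  mean_shift : forall f n, bdd f -> L (fun x => f (x + n)) = L f }.

Lemma window_bound (f : int -> R) C x M :
  (forall y, `|f y| <= C) -> `|window f x M| <= C * M%:R.
Proof.
move=> hC; apply: (le_trans (ler_norm_sum _ _ _)).
rewrite mulr_natr -[M in leRHS]card_ord -sumr_const.
by apply: ler_sum => i _.
Qed.

Lemma window_shift1 (f : int -> R) x M :
  window (fun y => f (y + 1)) x M = window f x M + f (x + M%:Z) - f x.
Proof.
rewrite /window.
have -> : \sum_(i < M) f (x + i%:Z) + f (x + M%:Z) = \sum_(i < M.+1) f (x + i%:Z).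
  by rewrite big_ord_recr.
rewrite big_ord_recl /= addr0 addrC addKr; apply: eq_bigr => i _.
by rewrite /bump /= -addrA; congr (f (_ + _)); lia.
Qed.

(** Averages over windows within [1 / (M + 1)] of the maximal count for [B] give the second clause.
    Any other [E] has at most the maximal count in these windows, whence the third clause, which
    later turns a lower bound on [L] into one on the density. *)
Lemma exists_mean (B : set int) : exists L : (int -> R) -> R,
  [/\ is_mean L, L \1_B = upper_banach_density R B &
      forall E : set int, L \1_E <= upper_banach_density R E].
Proof.
have [U [UU hU]] := nat_ultrafilter.
have e0 (M : nat) : (0 : R) < M.+1%:R^-1 by rewrite invr_gt0.
have [N hN] := choice (fun M => max_window_attained B M (e0 M)).
pose a f M : R := window f (N M) M / M%:R.
have a_bdd f : bdd f -> bdd (a f).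
  move=> [C hC]; exists C => M; rewrite /a normrM.
  have [->|M0] := posnP M.
    by rewrite invr0 normr0 mulr0 (le_trans _ (hC 0)).
  rewrite [X in _ * X]ger0_norm// ler_pdivrMr ?ltr0n//; exact: window_bound.
have aU f : bdd f -> a f @ U --> lim (a f @ U) by move=> /a_bdd; exact: ultra_cvg.
have cvgU (u : nat -> R) (l : R) : u @ \oo --> l -> u @ U --> l.
  by move=> h A /h hA; apply: hU.
pose L f := lim (a f @ U).
have LD f g : bdd f -> bdd g -> L (fun x => f x + g x) = L f + L g.
  move=> bf bg; apply: cvg_lim => //.
  have -> : a (fun x => f x + g x) = a f + a g.
    by apply/funext => M; rewrite /a /window big_split mulrDl.
  by apply: cvgD; exact: aU.
(* A shift by 1 alters a window sum by its two end terms only, and these vanish after division by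
   [M]. *)
have L1 f : bdd f -> L (fun x => f (x + 1)) = L f.
  move=> bf; have [C hC] := bf; apply: cvg_lim => //.
  have -> : a (fun x => f (x + 1)) = a f +
      (fun M => (f (N M + M%:Z) - f (N M)) / M%:R).
    by apply/funext => M; rewrite /a window_shift1 -addrA mulrDl.
  rewrite -[X in _ --> X]addr0; apply: cvgD; first exact: aU.
  apply: cvgU; apply/cvgr0Pnorm_le => e ep.
  near=> M; rewrite normrM [X in _ * X]ger0_norm// ler_pdivrMr; last first.
    by rewrite ltr0n; near: M; exact: nbhs_infty_gt.
  apply: (@le_trans _ _ (C + C)); first by rewrite (le_trans (ler_normB _ _))// lerD.
  by rewrite -ler_pdivrMl//; near: M; apply: nbhs_infty_ger.
exists L; split.
- split => //.
  + move=> c f bf; apply: cvg_lim => //.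
    have -> : a (fun x => c * f x) = (fun M => c * a f M).
      by apply/funext => M; rewrite /a /window -mulr_sumr mulrA.
    by apply: cvgMl_tmp; exact: aU.
  + move=> c; apply: cvg_lim => //; apply: cvgU.
    have : (fun=> c) @ \oo --> c by exact: cvg_cst.
    apply: cvg_trans; apply: near_eq_cvg; near=> M.
    rewrite /a /window sumr_const card_ord -[c *+ M]mulr_natr mulfK//.
    by rewrite pnatr_eq0 -lt0n; near: M; exact: nbhs_infty_gt.
  + move=> f g bf bg fg; apply: (ler_cvg_to (aU _ bf) (aU _ bg)).
    apply: nearW => M; rewrite /a ler_wpM2r//; exact: ler_sum.
  + have Lnat f n : bdd f -> L (fun x => f (x + n%:Z)) = L f.
      move=> bf; elim: n => [|n IH].
        by congr L; apply/funext => x; rewrite addr0.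
      rewrite -IH -[RHS]L1; last exact: (bdd_comp (fun x => x + n%:Z) bf).
      by congr L; apply/funext => x; congr f; lia.
    move=> f [n|n] bf; first exact: Lnat.
    (* A negative shift is undone by a positive shift of the shifted function. *)
    rewrite -[LHS](Lnat _ n.+1); last exact: (bdd_comp (fun x => x + Negz n) bf).
    by congr L; apply/funext => x; congr f; lia.
- apply: cvg_lim => //; apply: cvgU; have mw := @cvg_max_window R B.
  apply: (@squeeze_cvgr _ _ _ _ (fun M => max_window B M / M%:R - M.+1%:R^-1)
            (fun M => max_window B M / M%:R)).
  + near=> M; have M0 : (0 < M)%N by near: M; exact: nbhs_infty_gt.
    rewrite /a; apply/andP; split; last first.
      by rewrite ler_wpM2r// window_le_max.
    rewrite lerBlDr -lerBlDl -mulrBl (@le_trans _ _ (max_window B M - window \1_B (N M) M))//.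
      rewrite ler_pdivrMr ?ltr0n// ler_peMr ?ler1n//.
      by rewrite subr_ge0 window_le_max.
    by rewrite lerBlDr -lerBlDl; exact: ltW (hN M).
  + rewrite -[X in _ --> X]subr0; apply: cvgB => //; exact: cvg_harmonic.
  + exact: mw.
- move=> E; have mw := cvgU _ _ (@cvg_max_window R E).
  apply: (ler_cvg_to (aU _ (bdd_indic E)) mw).
  by apply: nearW => M; rewrite /a ler_wpM2r// window_le_max.
Unshelve. all: by end_near. Qed.

End InvariantMean.

(** * Herglotz's theorem *)

Section UnitIntegral.
Context {R : realType}.
Implicit Types (f g : R -> R).

Definition bdd_meas f := measurable_fun setT f /\ bdd f.

Definition I01 f : R := \int[lebesgue_measure]_(s in `[0, 1]) f s.

Lemma bdd_meas_cst (c : R) : bdd_meas (fun=> c).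
Proof. by split; [exact: measurable_cst|exact: bdd_cst]. Qed.

Lemma bdd_measD f g : bdd_meas f -> bdd_meas g -> bdd_meas (fun x => f x + g x).
Proof. by move=> [mf bf] [mg bg]; split; [exact: measurable_funD|exact: bddD]. Qed.

Lemma bdd_measM f g : bdd_meas f -> bdd_meas g -> bdd_meas (fun x => f x * g x).
Proof. by move=> [mf bf] [mg bg]; split; [exact: measurable_funM|exact: bddM]. Qed.

Lemma bdd_measZ c f : bdd_meas f -> bdd_meas (fun x => c * f x).
Proof. by move=> ?; apply: bdd_measM => //; exact: bdd_meas_cst. Qed.

Lemma bdd_meas_sum (T : Type) (r : seq T) (f : T -> R -> R) :
  (forall i, bdd_meas (f i)) -> bdd_meas (fun x => \sum_(i <- r) f i x).
Proof.
move=> h; elim: r => [|i r IH].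
  by under eq_fun do rewrite big_nil; exact: bdd_meas_cst.
by under eq_fun do rewrite big_cons; apply: bdd_measD.
Qed.

Lemma bdd_meas_indic (S : set R) : measurable S -> bdd_meas \1_S.
Proof.
move=> mS; by split; [exact: measurable_indic|exact: bdd_indic].
Qed.

Lemma lebesgue01 : lebesgue_measure (`[0, 1]%classic : set R) = 1%E.
Proof. by rewrite lebesgue_measure_itv /= lte_fin ltr01 oppr0 adde0. Qed.

Lemma bdd_meas_integrable f : bdd_meas f ->
  (@lebesgue_measure R).-integrable `[0, 1] (EFin \o f).
Proof.
move=> [mf [C hC]]; apply: measurable_bounded_integrable => //.
- by rewrite [ltLHS]lebesgue01 ltry.
- exact: measurable_funS mf.
- by exists C; split; [exact: num_real|] => x Cx y _ /=; apply: (le_trans (hC y)); exact: ltW.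
Qed.

Lemma I01D f g : bdd_meas f -> bdd_meas g -> I01 (fun x => f x + g x) = I01 f + I01 g.
Proof. by move=> bf bg; apply: RintegralD => //; exact: bdd_meas_integrable. Qed.

Lemma I01Z c f : bdd_meas f -> I01 (fun x => c * f x) = c * I01 f.
Proof. by move=> bf; apply: RintegralZl => //; exact: bdd_meas_integrable. Qed.

Lemma I01_cst c : I01 (fun=> c) = c.
Proof. by rewrite /I01 Rintegral_cst//= lebesgue01 mulr1. Qed.

Lemma le_I01 f g : bdd_meas f -> bdd_meas g -> (forall s, 0 <= s <= 1 -> f s <= g s) -> I01 f <= I01 g.
Proof.
move=> bf bg h; apply: le_Rintegral => //; exact: bdd_meas_integrable.
Qed.

Lemma eq_I01 f g : (forall s, 0 <= s <= 1 -> f s = g s) -> I01 f = I01 g.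
Proof.
by move=> h; apply: eq_Rintegral => x /set_mem /=; rewrite in_itv /=; exact: h.
Qed.

Lemma I01_sum (T : Type) (r : seq T) (f : T -> R -> R) :
  (forall i, bdd_meas (f i)) -> I01 (fun x => \sum_(i <- r) f i x) = \sum_(i <- r) I01 (f i).
Proof.
move=> h; elim: r => [|i r IH].
  by under eq_fun do rewrite big_nil; rewrite I01_cst big_nil.
under eq_fun do rewrite big_cons.
by rewrite I01D// ?IH ?big_cons//; exact: bdd_meas_sum.
Qed.

Lemma I01_dct (u : nat -> R -> R) (v : R -> R) (C : R) :
  (forall j, bdd_meas (u j)) -> bdd_meas v -> (forall j s, `|u j s| <= C) ->
  (forall s, (u ^~ s) @ \oo --> v s) -> (fun j => I01 (u j)) @ \oo --> I01 v.
Proof.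
move=> bu bv hC uv.
have := @dominated_convergence _ _ R (@lebesgue_measure R) `[0, 1]%classic
  _ (fun j => EFin \o u j) (EFin \o v) (cst C%:E).
case=> //.
- move=> j; apply/measurable_EFinP; exact: measurable_funS (bu j).1.
- apply/measurable_EFinP; exact: measurable_funS bv.1.
- by apply: nearW => x _; apply: cvg_EFin => //; [exact: nearW|exact: uv].
- exact: (bdd_meas_integrable (bdd_meas_cst C)).
- by apply: nearW => x j _ /=; rewrite lee_fin.
move=> _ _ h; apply: (fine_cvg (a := I01 v)).
rewrite /I01 /Rintegral fineK//.
by apply: integrable_fin_num => //; exact: bdd_meas_integrable.
Qed.

Lemma I01_indic_itv (a : R) : 0 <= a <= 1 -> I01 \1_`[a, +oo[ = 1 - a.
Proof.
move=> /andP[a0 a1].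
rewrite /I01 /Rintegral integral_indic//=.
have -> : `[a, +oo[ `&` `[0, 1] = `[a, 1]%classic.
  apply/seteqP; split => x /=; rewrite !in_itv /= ?andbT.
    by move=> [-> /andP[_ ->]].
  by move=> /andP[ax ->]; rewrite ax (le_trans a0 ax).
by rewrite lebesgue_measure_itv /= lte_fin; case: ltgtP a1 => //= -> _; rewrite subrr.
Qed.

Lemma le_I01_indic (S : set R) (a b : R) : measurable S -> a <= b ->
  S `<=` `[a, b] -> I01 \1_S <= b - a.
Proof.
move=> mS ab Sab; rewrite /I01 /Rintegral integral_indic//=.
rewrite -lee_fin fineK; last first.
  rewrite ge0_fin_numE//; apply: (@le_lt_trans _ _ (lebesgue_measure (`[0, 1]%classic : set R))).
    by apply: le_measure => //; apply: mem_set; do ?apply: measurableI.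
  by rewrite [ltLHS]lebesgue01 ltry.
apply: (@le_trans _ _ (lebesgue_measure (`[a, b]%classic : set R))).
  apply: le_measure; last by move=> x [/Sab].
    by apply: mem_set; apply: measurableI.
  exact: mem_set.
by rewrite lebesgue_measure_itv /= lte_fin; case: ltgtP ab => //= -> _; rewrite subrr.
Qed.

(** The preimage of a ray under a monotone function is an interval. *)
Lemma nondecreasing_measurable f : {homo f : x y / x <= y} -> measurable_fun setT f.
Proof.
move=> nf mD; apply: (measurability _ (RGenOInfty.measurableE R)) => //.
move=> /= _ [_ [a ->] <-]; rewrite setTI.
apply: is_interval_measurable => x y /=; rewrite !in_itv /= !andbT => ax ay z /andP[xz _].
rewrite /= ?in_itv /= ?andbT; exact: (lt_le_trans ax (nf _ _ xz)).
Qed.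

End UnitIntegral.

(** * Fejer weights on a finite grid *)

Section FourierGrid.
Context {R : realType}.

Lemma cos_lipschitz (x y : R) : `|cos x - cos y| <= `|x - y|.
Proof.
wlog xy : x y / x <= y.
  move=> h; case: (leP x y) => [/h//|/ltW/h].
  by rewrite distrC [in leRHS]distrC.
have [|c _ e] := @MVT_segment R cos (- sin)%R x y xy (fun z _ => is_derive_cos z).
  by apply: continuous_subspaceT; exact: continuous_cos.
rewrite distrC [in leRHS]distrC e normrM ler_piMl//.
by rewrite normrN sin_max.
Qed.

Definition grid (K r : nat) : R := pi *+ 2 * r%:R / K%:R.

(** Multiplication by [2 * sin y] with [y = pi * m / K] makes the sum telescope, and periodicity
    cancels the two ends; [sin y] is nonzero since [0 < m < K]. *)
Lemma sum_cos_grid (K m : nat) : (0 < m < K)%N ->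
  \sum_(r < K) cos (m%:R * grid K r) = 0.
Proof.
move=> /andP[m0 mK].
have K0 : (0 : R) < K%:R by rewrite ltr0n (leq_trans m0 (ltnW mK)).
pose y : R := pi * m%:R / K%:R.
have siny : sin y != 0.
  rewrite gt_eqF// sin_gt0_pi//; apply/andP; split.
    by rewrite divr_gt0// mulr_gt0 ?pi_gt0// ltr0n.
  by rewrite /y ltr_pdivrMr// ltr_pM2l ?pi_gt0// ltr_nat.
have tele n : \sum_(r < n) 2 * sin y * cos (m%:R * grid K r) =
    sin (2 * n%:R * y - y) + sin y.
  elim: n => [|n IH]; first by rewrite big_ord0 mulr0 mul0r add0r sinN addNr.
  rewrite big_ord_recr /= IH.
  have -> : m%:R * grid K n = 2 * n%:R * y by rewrite /grid /y mulr2n; ring.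
  have -> : 2 * n.+1%:R * y - y = 2 * n%:R * y + y by rewrite -natr1; ring.
  by rewrite sinB sinD; ring.
have := tele K; rewrite -mulr_sumr.
have -> : 2 * K%:R * y - y = - y + pi *+ 2 *+ m.
  by rewrite /y -[_ *+ m]mulr_natr mulr2n; field; rewrite gt_eqF.
rewrite (periodicn (@sinD2pi R)) sinN addNr => /eqP.
by rewrite !mulf_eq0 (negbTE siny) pnatr_eq0 /= => /eqP.
Qed.

Lemma sum_cos_grid_int (K : nat) (m : int) : (0 < K)%N -> `|m| < K%:Z ->
  \sum_(r < K) cos (m%:~R * grid K r) = (m == 0)%:R * K%:R.
Proof.
move=> K0 mK; have [->|m0] := eqVneq m 0.
  under eq_bigr do rewrite mul0r cos0.
  by rewrite sumr_const card_ord mul1r.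
rewrite mul0r -[RHS](@sum_cos_grid K `|m|%N); last by lia.
apply: eq_bigr => r _; case: m {m0 mK} => n //.
by rewrite NegzE abszN -[in RHS]cosN mulrNz mulNr.
Qed.

(** Real coefficients suffice for an even [g]: a complex test vector splits into its real and
    imaginary parts, as in [fejer_ge0]. *)
Definition posdef (g : int -> R) :=
  forall (n : nat) (c : nat -> R),
    0 <= \sum_(i < n) \sum_(j < n) c i * c j * g (i%:Z - j%:Z).

Section FejerWeights.
Variables (g : int -> R) (N : nat).
Hypothesis g_posdef : posdef g.
Hypothesis g_even : forall n, g (- n) = g n.
Hypothesis N0 : (0 < N)%N.

(** A difference of two indices below [N], shifted by some [n < N], stays below [2 N] in absolute
    value, so a grid of [2 N] points causes no aliasing. *)
Let K := (N * 2)%N.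

(** This is the Fejer mean of order [N] of the Fourier series with coefficients [g], sampled at a
    grid point and divided by the number of grid points. *)
Definition fejer (r : nat) : R :=
  (\sum_(h < N) \sum_(h' < N) g (h%:Z - h'%:Z) * cos ((h%:Z - h'%:Z)%:~R * grid K r))
  / (N%:R * K%:R).

Lemma fejer_ge0 r : 0 <= fejer r.
Proof.
rewrite /fejer divr_ge0// ?mulr_ge0//.
have := addr_ge0 (@g_posdef N (fun h => cos (h%:R * grid K r)))
                 (@g_posdef N (fun h => sin (h%:R * grid K r))).
rewrite -big_split /= (eq_bigr (fun h : 'I_N => \sum_(h' < N) g (h%:Z - h'%:Z) * cos ((h%:Z - h'%:Z)%:~R * grid K r)))//.
move=> h _; rewrite -big_split /=; apply: eq_bigr => h' _.
by rewrite intrD mulrNz !mulrDl mulNr cosB -!pmulrn; ring.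
Qed.

(** Orthogonality on the grid keeps the pairs with [h - h' = n] or [h - h' = - n]. There are [N - n]
    of each kind, and evenness of [g] gives both the same contribution [X]. *)
Lemma fejer_moment (n : nat) : (n < N)%N ->
  \sum_(r < K) fejer r * cos (n%:R * grid K r) = (1 - n%:R / N%:R) * g n%:Z.
Proof.
move=> nN.
have K0 : (0 < K)%N by rewrite muln_gt0 N0.
have NR : (0 : R) < N%:R by rewrite ltr0n.
have KR : (0 : R) < K%:R by rewrite ltr0n.
pose X := \sum_(h < N) \sum_(h' < N) g (h%:Z - h'%:Z) * (h%:Z - h'%:Z - n%:Z == 0)%:R.
have XE : X = (N - n)%:R * g n%:Z.
  rewrite /X exchange_big /=.
  rewrite (eq_bigr (fun h' : 'I_N => if (h' < N - n)%N then g n%:Z else 0)); last first.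
    move=> h' _; case: ltnP => h'N.
      have hlt : (h' + n < N)%N by lia.
      rewrite (bigD1 (Ordinal hlt)) //= big1 ?addr0.
        by rewrite (_ : _ - _ = n%:Z) ?subrr ?eqxx ?mulr1//; lia.
      move=> i /eqP ne; case: eqP => [e|]; last by rewrite mulr0.
      by case: ne; apply/val_inj => /=; lia.
    rewrite big1// => i _; case: eqP => [e|]; last by rewrite mulr0.
    by have := ltn_ord i; lia.
  rewrite -big_mkcond /= -(big_ord_widen _ (fun=> g n%:Z)) ?leq_subr//.
  by rewrite sumr_const card_ord mulr_natl.
have XE' : \sum_(h < N) \sum_(h' < N) g (h%:Z - h'%:Z) * (h%:Z - h'%:Z + n%:Z == 0)%:R = X.
  rewrite /X exchange_big /=; apply: eq_bigr => h _; apply: eq_bigr => h' _.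
  by rewrite -g_even opprB; congr (_ * (_)%:R); lia.
have -> : \sum_(r < K) fejer r * cos (n%:R * grid K r) =
    (\sum_(h < N) \sum_(h' < N) g (h%:Z - h'%:Z) *
      \sum_(r < K) cos ((h%:Z - h'%:Z)%:~R * grid K r) * cos (n%:R * grid K r))
    / (N%:R * K%:R).
  rewrite mulr_suml.
  under [RHS]eq_bigr do rewrite mulr_suml.
  under [LHS]eq_bigr do rewrite /fejer mulr_suml mulr_suml.
  rewrite exchange_big /=; apply: eq_bigr => h _.
  under [LHS]eq_bigr do rewrite mulr_suml mulr_suml.
  rewrite exchange_big /=; apply: eq_bigr => h' _.
  by rewrite mulr_sumr mulr_suml; apply: eq_bigr => r _; ring.
have inner (a : int) : `|a| < N%:Z ->
    \sum_(r < K) cos (a%:~R * grid K r) * cos (n%:R * grid K r) =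
    K%:R / 2 * ((a + n%:Z == 0)%:R + (a - n%:Z == 0)%:R).
  move=> aN.
  have -> : \sum_(r < K) cos (a%:~R * grid K r) * cos (n%:R * grid K r) =
    (\sum_(r < K) cos ((a + n%:Z)%:~R * grid K r) +
     \sum_(r < K) cos ((a - n%:Z)%:~R * grid K r)) / 2.
    rewrite -big_split mulr_suml; apply: eq_bigr => r _ /=.
    by rewrite !intrD mulrNz !mulrDl mulNr cosB cosD -!pmulrn; field.
  rewrite !sum_cos_grid_int// ?/K; try lia.
  by field.
have -> : \sum_(h < N) \sum_(h' < N) g (h%:Z - h'%:Z) *
      \sum_(r < K) cos ((h%:Z - h'%:Z)%:~R * grid K r) * cos (n%:R * grid K r) =
    K%:R / 2 * (X + X).
  rewrite -{1}XE' /X -big_split mulr_sumr; apply: eq_bigr => h _ /=.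
  rewrite -big_split mulr_sumr; apply: eq_bigr => h' _ /=.
  rewrite inner; first by ring.
  by have := ltn_ord h; have := ltn_ord h'; lia.
rewrite XE natrB ?(ltnW nN)//; field.
by rewrite !gt_eqF.
Qed.

End FejerWeights.

End FourierGrid.

(** * Quantile function of a finite distribution *)

Section Quantile.
Context {R : realType}.
Variables (p : nat -> R).
Hypothesis p0 : forall r, 0 <= p r.

Definition cumul (r : nat) : R := \sum_(i < r) p i.

(** The generalised inverse of [cumul], written as a count of the thresholds passed, so that
    functions of it are finite combinations of indicators of rays. *)
Definition quantile_index (m : nat) (s : R) : nat := (\sum_(r < m) (cumul r.+1 <= s)%R)%N.

Lemma cumul_homo : {homo cumul : r q / (r <= q)%N >-> r <= q}.
Proof.
apply: homo_leq => //; first by move=> y x z; exact: le_trans.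
by move=> r; rewrite /cumul big_ord_recr lerDl.
Qed.

Lemma quantile_index_full m s : cumul m <= s -> quantile_index m s = m.
Proof.
move=> h; rewrite /quantile_index -[RHS]card_ord -sum1_card; apply: eq_bigr => i _.
by rewrite (le_trans (cumul_homo (ltn_ord i)) h).
Qed.

Lemma quantile_indexE (f : nat -> R) m s :
  f (quantile_index m s) =
    f 0%N + \sum_(r < m) (f r.+1 - f r) * \1_`[cumul r.+1, +oo[ s.
Proof.
elim: m => [|m IH]; first by rewrite /quantile_index !big_ord0 addr0.
rewrite [in RHS]big_ord_recr /= addrA -IH /quantile_index big_ord_recr /=.
rewrite indicE mem_setE in_itv /= andbT.
case: (leP (cumul m.+1) s) => h; last by rewrite mulr0 addr0 addn0.
rewrite mulr1 -/(quantile_index m s) quantile_index_full ?addn1; first by rewrite addrCA subrr addr0.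
exact: le_trans (cumul_homo (leqnSn m)) h.
Qed.

Lemma bdd_meas_quantile_index (f : nat -> R) m : bdd_meas (fun s => f (quantile_index m s)).
Proof.
under eq_fun do rewrite quantile_indexE.
apply: bdd_measD; first exact: bdd_meas_cst.
by apply: bdd_meas_sum => r; apply: bdd_measZ; apply: bdd_meas_indic.
Qed.

(** Index [r < m] is taken on an interval of length [p r]; the leftover mass [1 - cumul m] falls on
    index [m]. *)
Lemma I01_quantile_index (f : nat -> R) m : cumul m <= 1 ->
  I01 (fun s => f (quantile_index m s)) =
    \sum_(r < m) f r * p r + f m * (1 - cumul m).
Proof.
move=> m1; rewrite (eq_I01 (g := fun s => f 0%N +
    \sum_(r < m) (f r.+1 - f r) * \1_`[cumul r.+1, +oo[ s)); last first.
  by move=> s _; rewrite quantile_indexE.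
have bi r : bdd_meas (fun s : R => (f r.+1 - f r) * \1_`[cumul r.+1, +oo[ s).
  by apply: bdd_measZ; exact: bdd_meas_indic.
rewrite I01D ?I01_cst; [|exact: bdd_meas_cst|exact: bdd_meas_sum].
rewrite I01_sum//.
elim: m m1 => [|m IH] m1.
  by rewrite !big_ord0 /cumul big_ord0 subr0 mulr1 addr0 add0r.
have m1' : cumul m <= 1 by apply: le_trans m1; exact: cumul_homo.
rewrite big_ord_recr addrA IH//= I01Z; last exact: bdd_meas_indic.
rewrite I01_indic_itv; last by rewrite m1 andbT sumr_ge0.
rewrite [in RHS]big_ord_recr /= /cumul [\sum_(i < m.+1) p i]big_ord_recr /=.
ring.
Qed.

Lemma quantile_indexS m s : quantile_index m.+1 s =
  if cumul m.+1 <= s then m.+1 else quantile_index m s.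
Proof.
case: ifP => h; first exact: quantile_index_full.
by rewrite /quantile_index big_ord_recr /= h addn0.
Qed.

Lemma cumul_quantile_index_le m s : 0 <= s -> cumul (quantile_index m s) <= s.
Proof.
move=> s0; elim: m => [|m IH]; first by rewrite /quantile_index /cumul !big_ord0.
by rewrite quantile_indexS; case: ifP.
Qed.

Lemma cumul_quantile_index_ge m s : s <= cumul m -> s <= cumul (quantile_index m s).+1.
Proof.
elim: m => [|m IH] sm; first exact: (le_trans sm (cumul_homo (leq0n _))).
rewrite quantile_indexS; case: ifP => [_|_]; first exact: (le_trans sm (cumul_homo (leqnSn _))).
by case: (leP s (cumul m)) => [/IH//|/ltW/quantile_index_full ->].
Qed.

End Quantile.

Section Herglotz.
Context {R : realType}.

Lemma pi2_gt0 : (0 : R) < pi *+ 2.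
Proof. by rewrite pmulrn_lgt0// pi_gt0. Qed.

Lemma bdd_meas_cos (n : R) (G : R -> R) : measurable_fun setT G -> bdd_meas (fun s => cos (n * G s)).
Proof.
move=> mG; split; last by exists 1 => s; exact: cos_max.
apply: measurableT_comp; first by apply: continuous_measurable_fun; exact: continuous_cos.
exact: measurable_funM.
Qed.

Lemma bdd_meas_sin (n : R) (G : R -> R) : measurable_fun setT G -> bdd_meas (fun s => sin (n * G s)).
Proof.
move=> mG; split; last by exists 1 => s; exact: sin_max.
apply: measurableT_comp; first by apply: continuous_measurable_fun; exact: continuous_sin.
exact: measurable_funM.
Qed.

(** The bound is the same for every monotone [G] into [[0, 2 pi]]: cosine is 1-Lipschitz and the
    increments of [G] over the cells add up to at most [2 pi]. This uniformity carries integrals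
    through a pointwise ultralimit, where dominated convergence for sequences does not apply. *)
Lemma riemann_cos (G : R -> R) (n L : nat) :
  {homo G : x y / x <= y} -> (forall s, 0 <= G s <= pi *+ 2) -> (0 < L)%N ->
  `|I01 (fun s => cos (n%:R * G s)) - (\sum_(i < L) cos (n%:R * G (i%:R / L%:R))) / L%:R|
    <= n%:R * pi *+ 2 / L%:R.
Proof.
move=> nG G2 L0; have LR : (0 : R) < L%:R by rewrite ltr0n.
have mG := nondecreasing_measurable nG.
(* With equal masses [1 / L], [quantile_index] is the step function selecting the cell of [s], so
   the Riemann sum is itself an integral. *)
pose p (_ : nat) : R := L%:R^-1; have p0 r : 0 <= p r by rewrite invr_ge0.
have cumulE r : cumul p r = r%:R / L%:R by rewrite /cumul sumr_const card_ord mulr_natl.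
have cL : cumul p L = 1 by rewrite cumulE divff// gt_eqF.
have bc (f : nat -> R) := bdd_meas_quantile_index p0 f L.
have Ic f : I01 (fun s => f (quantile_index p L s)) = (\sum_(i < L) f i) / L%:R.
  by rewrite I01_quantile_index ?cL// subrr mulr0 addr0 mulr_suml.
rewrite -(Ic (fun i => cos (n%:R * G (i%:R / L%:R)))).
pose w i := n%:R * (G (i.+1%:R / L%:R) - G (i%:R / L%:R)).
have Iw : I01 (fun s => w (quantile_index p L s)) <= n%:R * pi *+ 2 / L%:R.
  rewrite Ic ler_pM2r ?invr_gt0// /w -mulr_sumr -mulrnAr ler_wpM2l//.
  have -> : \sum_(i < L) (G (i.+1%:R / L%:R) - G (i%:R / L%:R)) =
      G (L%:R / L%:R) - G (0%:R / L%:R).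
    by rewrite -(big_mkord xpredT (fun i => G (i.+1%:R / L%:R) - G (i%:R / L%:R))) telescope_sumr.
  by have := G2 (L%:R / L%:R); have := G2 (0%:R / L%:R); lra.
have pw s : 0 <= s <= 1 -> `|cos (n%:R * G s) -
    cos (n%:R * G ((quantile_index p L s)%:R / L%:R))| <= w (quantile_index p L s).
  move=> /andP[s0 s1]; apply: (le_trans (cos_lipschitz _ _)).
  rewrite -mulrBr normrM ger0_norm// ler_wpM2l//.
  have l1 := nG _ _ (cumul_quantile_index_le p0 L s0); rewrite cumulE in l1.
  rewrite -cL in s1.
  have l2 := nG _ _ (cumul_quantile_index_ge p0 s1); rewrite cumulE in l2.
  by rewrite ger0_norm ?lerD2r// subr_ge0.
have b1 := bdd_meas_cos n%:R mG.
have b2 := bc (fun i => cos (n%:R * G (i%:R / L%:R))).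
have b3 := bc w.
rewrite ler_norml; apply/andP; split.
  rewrite lerNl opprB lerBlDr; apply: (@le_trans _ _ (I01 (fun s =>
    w (quantile_index p L s) + cos (n%:R * G s)))).
    apply: le_I01 => //; first exact: bdd_measD.
    by move=> s /pw; rewrite ler_norml => /andP[+ _]; lra.
  by rewrite I01D// lerD2r.
rewrite lerBlDr; apply: (@le_trans _ _ (I01 (fun s =>
    w (quantile_index p L s) + cos (n%:R * G ((quantile_index p L s)%:R / L%:R))))).
  apply: le_I01 => //; first exact: bdd_measD.
  by move=> s /pw; rewrite ler_norml => /andP[_ +]; lra.
by rewrite I01D// lerD2r.
Qed.

Lemma fejer_sum (g : int -> R) (N : nat) : (forall n, g (- n) = g n) ->
  (0 < N)%N -> g 0 = 1 -> \sum_(r < N * 2) fejer g N r = 1.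
Proof.
move=> ge N0 g0; have := fejer_moment ge N0 N0; rewrite mul0r subr0 mul1r g0 => <-.
by apply: eq_bigr => r _; rewrite mul0r cos0 mulr1.
Qed.

(* The measure putting mass [fejer g N r] at the grid point [r] is the law of
   its quantile function under Lebesgue measure. *)
Lemma fejer_quantile (g : int -> R) (N : nat) :
  posdef g -> (forall n, g (- n) = g n) -> g 0 = 1 -> (0 < N)%N ->
  exists G : R -> R, [/\ {homo G : x y / x <= y},
    forall s, 0 <= G s <= pi *+ 2 &
    forall n : nat, (n < N)%N ->
      I01 (fun s => cos (n%:R * G s)) = (1 - n%:R / N%:R) * g n%:Z].
Proof.
move=> gp ge g0 N0; set K := (N * 2)%N.
have K0 : (0 < K)%N by rewrite muln_gt0 N0.
have KR : (0 : R) < K%:R by rewrite ltr0n.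
have f0 r : 0 <= fejer g N r by exact: fejer_ge0.
(* With only [K - 1] thresholds, the leftover mass on the last index is exactly the last Fejer
   weight. *)
exists (fun s => grid K (quantile_index (fejer g N) K.-1 s)); split.
- move=> x y xy; rewrite /grid ler_pM2r ?invr_gt0// ler_pM2l ?pi2_gt0//.
  rewrite ler_nat; apply: leq_sum => r _.
  case: (leP _ x) => // h; by rewrite (le_trans h xy).
- move=> s; rewrite /grid; apply/andP; split.
    by rewrite divr_ge0// mulr_ge0// ltW// pi2_gt0.
  rewrite ler_pdivrMr// ler_pM2l ?pi2_gt0// ler_nat.
  apply: (@leq_trans K.-1); last exact: leq_pred.
  rewrite -[leqRHS]card_ord -sum1_card; apply: leq_sum => i _; exact: leq_b1.
- move=> n nN.
  have sK : cumul (fejer g N) K.-1.+1 = 1 by rewrite prednK// /cumul fejer_sum.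
  rewrite (I01_quantile_index f0 (fun i => cos (n%:R * grid K i))); last first.
    by rewrite -sK cumul_homo.
  rewrite -(fejer_moment ge N0 nN) -/K.
  transitivity (\sum_(r < K.-1.+1) fejer g N r * cos (n%:R * grid K r)); last first.
    by rewrite (prednK K0).
  rewrite big_ord_recr /=; congr (_ + _); first by apply: eq_bigr => i _; rewrite mulrC.
  rewrite mulrC; congr (_ * _).
  by move: sK; rewrite /cumul big_ord_recr /=; lra.
Qed.

(** [G] is the pointwise ultralimit of the Fejer quantile functions, whose moments
    [(1 - m / (N + 1)) * g m] tend to [g m]. *)
Lemma herglotz (g : int -> R) :
  posdef g -> (forall n, g (- n) = g n) -> g 0 = 1 ->
  exists G : R -> R, [/\ {homo G : x y / x <= y},
    forall s, 0 <= G s <= pi *+ 2 &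
    forall n : int, I01 (fun s => cos (n%:~R * G s)) = g n].
Proof.
move=> gp ge g0; have [U [UU hU]] := nat_ultrafilter.
have /choice[H HP] := fun N => fejer_quantile gp ge g0 (ltn0Sn N).
have bH s : bdd (fun N => H N s).
  have C0 : (0 : R) <= pi *+ 2 by rewrite ltW// pi2_gt0.
  by exists (pi *+ 2) => N; have [_ /(_ s) /andP[a b] _] := HP N; rewrite ger0_norm.
pose G s : R := lim ((fun N => H N s) @ U).
have cG s : (fun N => H N s) @ U --> (G s : R) by exact: ultra_cvg (bH s).
have nG : {homo G : x y / x <= y}.
  move=> x y xy; have cx := cG x; have cy := cG y.
  apply: (ler_cvg_to cx cy); apply: nearW => N.
  by have [h _ _] := HP N; exact: h.
have G2 s : 0 <= G s <= pi *+ 2.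
  apply/andP; split.
    by apply: (cvgr_to_ge (cG s)); apply: nearW => N; have [_ /(_ s)/andP[]] := HP N.
  by apply: (cvgr_to_le (cG s)); apply: nearW => N; have [_ /(_ s)/andP[]] := HP N.
exists G; split => // n.
wlog [m ->] : n / exists m : nat, n = m%:Z.
  move=> h; case: n => m; first by apply: h; exists m.
  rewrite -ge NegzE opprK -(h m.+1%:Z); last by exists m.+1.
  by apply: eq_I01 => s _; rewrite mulrNz mulNr cosN.
pose rs L (F : R -> R) : R := (\sum_(i < L) cos (m%:R * F (i%:R / L%:R))) / L%:R.
(* Finite Riemann sums pass to the ultralimit. Two Riemann errors, one for [G] and one for the
   approximants, make up the factor 4. *)
have key L : (0 < L)%N -> `|I01 (fun s => cos (m%:R * G s)) - g m| <= m%:R * pi *+ 4 / L%:R.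
  move=> L0.
  have h1 : `|I01 (fun s => cos (m%:R * G s)) - rs L G| <= m%:R * pi *+ 2 / L%:R.
    exact: riemann_cos.
  have h2 : `|g m - rs L G| <= m%:R * pi *+ 2 / L%:R.
    have c1 : (fun N => rs L (H N)) @ U --> rs L G.
      apply: cvgMr_tmp; rewrite /=.
      apply: cvg_sumr => i.
      apply: (@continuous_cvg _ _ _ _ _ _ cos); first exact: continuous_cos.
      by apply: cvgMl_tmp; exact: cG.
    have c2 : (fun N => I01 (fun s => cos (m%:R * H N s))) @ U --> g m.
      apply: (cvg_trans (G := (fun N => (1 - m%:R / N.+1%:R) * g m) @ U)).
        apply: near_eq_cvg; apply: hU; near=> N.
        have [_ _ ->//] := HP N.
        by rewrite ltnS; near: N; exact: nbhs_infty_ge.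
      have : (fun N => (1 - m%:R / N.+1%:R) * g m) @ \oo --> (1 - m%:R * 0) * g m.
        apply: cvgMr_tmp; apply: cvgB; first exact: cvg_cst.
        by apply: cvgMl_tmp; exact: cvg_harmonic.
      rewrite mulr0 subr0 mul1r => h A /h hA; exact: hU.
    have c3 : (fun N => `|I01 (fun s => cos (m%:R * H N s)) - rs L (H N)|) @ U -->
        `|g m - rs L G| by apply: cvg_norm; exact: cvgB.
    apply: (cvgr_to_le c3); apply: nearW => N.
    have [a b _] := HP N; exact: riemann_cos.
  have := ler_distD (rs L G) (I01 (fun s => cos (m%:R * G s))) (g m).
  rewrite distrC in h2.
  have -> : m%:R * pi *+ 4 / L%:R = m%:R * pi *+ 2 / L%:R + m%:R * pi *+ 2 / L%:R :> R.
    by rewrite -mulrDl -mulrnDr.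
  by move=> h; apply: (le_trans h); exact: lerD.
have -> : (fun s => cos (m%:Z%:~R * G s)) = (fun s => cos (m%:R * G s)) by [].
apply/eqP; rewrite -subr_eq0 -normr_le0; apply/ler_addgt0Pr => e e0; rewrite add0r.
pose C : R := m%:R * pi *+ 4.
have [L] : exists L : nat, C / e <= L.+1%:R.
  exists (Num.truncn (C / e)); exact/ltW/truncnS_gt.
rewrite ler_pdivrMr// mulrC -ler_pdivrMr ?ltr0n// => h.
exact: le_trans (key L.+1 _) h.
Unshelve. all: by end_near. Qed.

End Herglotz.

(** * Spectral measure of a set *)

Section Weights.
Context {R : realType}.
Implicit Types (s : seq (R * int)) (t : R) (b : int -> R).

(* A list of (mass, position) pairs stands for a finitely supported measure on
   the integers; [power s t] is the squared modulus of its Fourier transform. *)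
Definition power s t : R :=
  (\sum_(p <- s) p.1 * cos (p.2%:~R * t)) ^+ 2 +
  (\sum_(p <- s) p.1 * sin (p.2%:~R * t)) ^+ 2.

Definition conv s b (x : int) : R := \sum_(p <- s) p.1 * b (x - p.2).

Lemma power_ge0 s t : 0 <= power s t.
Proof. by rewrite addr_ge0 ?sqr_ge0. Qed.

Lemma powerE s t : power s t =
  \sum_(p <- s) \sum_(q <- s) p.1 * q.1 * cos ((p.2 - q.2)%:~R * t).
Proof.
rewrite /power !expr2 !mulr_suml -big_split; apply: eq_bigr => p _ /=.
rewrite !mulr_sumr -big_split; apply: eq_bigr => q _ /=.
by rewrite intrD mulrNz mulrDl mulNr cosB; ring.
Qed.

Lemma powerN s t : power s (- t) = power s t.
Proof.
by rewrite !powerE; apply: eq_bigr => p _; apply: eq_bigr => q _; rewrite mulrN cosN.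
Qed.

(** Total mass at most 1, not equal to 1, so that restriction to a subset preserves the property. *)
Definition weight s := (forall p, p \in s -> 0 <= p.1) /\ \sum_(p <- s) p.1 <= 1.

Lemma weight_filter s (P : pred (R * int)) : weight s -> weight (seq.filter P s).
Proof.
move=> [s0 s1]; split; first by move=> p; rewrite mem_filter => /andP[_ /s0].
rewrite big_filter (le_trans _ s1)// big_mkcond big_seq [leRHS]big_seq.
by apply: ler_sum => p /s0; case: ifP.
Qed.

Lemma le_weight_sum2 s (F : R * int -> R * int -> R) C : weight s -> 0 <= C ->
  (forall p q, F p q <= C) ->
  \sum_(p <- s) \sum_(q <- s) p.1 * q.1 * F p q <= C.
Proof.
move=> [s0 s1] C0 h; have m0 : 0 <= \sum_(p <- s) p.1 by rewrite big_seq sumr_ge0.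
apply: (@le_trans _ _ (\sum_(p <- s) \sum_(q <- s) p.1 * q.1 * C)).
  rewrite big_seq [leRHS]big_seq; apply: ler_sum => p ps.
  rewrite big_seq [leRHS]big_seq; apply: ler_sum => q qs.
  by rewrite ler_wpM2l// mulr_ge0// s0.
have -> : \sum_(p <- s) \sum_(q <- s) p.1 * q.1 * C = (\sum_(p <- s) p.1) ^+ 2 * C.
  rewrite expr2 !mulr_suml; apply: eq_bigr => p _.
  by rewrite -mulrA mulr_suml mulr_sumr; apply: eq_bigr => q _; rewrite mulrA.
by rewrite ler_piMl// expr_le1.
Qed.

Lemma power_le1 s t : weight s -> power s t <= 1.
Proof. by move=> ws; rewrite powerE; apply: le_weight_sum2 => // p q; exact: cos_le1. Qed.

Lemma bdd_meas_power s (G : R -> R) : measurable_fun setT G -> bdd_meas (fun t => power s (G t)).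
Proof.
move=> mG; under eq_fun do rewrite powerE.
by apply: bdd_meas_sum => p; apply: bdd_meas_sum => q; apply: bdd_measZ; exact: bdd_meas_cos.
Qed.

Lemma bdd_conv s b : bdd b -> bdd (conv s b).
Proof.
move=> bb; apply: bdd_sum => p; apply: bddM; first exact: bdd_cst.
exact: (bdd_comp (fun x => x - p.2) bb).
Qed.

(** Signed masses make the difference of a convolution and its translate again a convolution, to
    which the spectral formula applies; its transform gains the factor
    [|1 - e^(i d t)|^2 = 2 - 2 cos (d t)]. *)
Definition translation_diff (d : int) s : seq (R * int) :=
  [seq (p.1, p.2 - d) | p <- s] ++ [seq (- p.1, p.2) | p <- s].

Lemma conv_translation_diff d s b x :
  conv (translation_diff d s) b x = conv s b (x + d) - conv s b x.
Proof.
rewrite /conv big_cat !big_map; congr (_ + _) => /=.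
  by apply: eq_bigr => p _; congr (_ * b _); ring.
by rewrite -sumrN; apply: eq_bigr => p _; rewrite mulNr.
Qed.

Lemma power_translation_diff d s t :
  power (translation_diff d s) t = power s t * (2 - 2 * cos (d%:~R * t)).
Proof.
rewrite /power !big_cat !big_map /=.
set c := cos (d%:~R * t); set z := sin (d%:~R * t).
pose C := \sum_(p <- s) p.1 * cos (p.2%:~R * t).
pose S := \sum_(p <- s) p.1 * sin (p.2%:~R * t).
have -> : \sum_(p <- s) p.1 * cos ((p.2 - d)%:~R * t) = c * C + z * S.
  rewrite /C /S !mulr_sumr -big_split; apply: eq_bigr => p _ /=.
  by rewrite intrD mulrNz mulrDl mulNr cosB /c /z; ring.
have -> : \sum_(p <- s) p.1 * sin ((p.2 - d)%:~R * t) = c * S - z * C.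
  rewrite /C /S !mulr_sumr -sumrB; apply: eq_bigr => p _ /=.
  by rewrite intrD mulrNz mulrDl mulNr sinB /c /z; ring.
have -> : \sum_(p <- s) - p.1 * cos (p.2%:~R * t) = - C.
  by rewrite /C -sumrN; apply: eq_bigr => p _; rewrite mulNr.
have -> : \sum_(p <- s) - p.1 * sin (p.2%:~R * t) = - S.
  by rewrite /S -sumrN; apply: eq_bigr => p _; rewrite mulNr.
rewrite -/C -/S.
have cz : z ^+ 2 = 1 - c ^+ 2 by rewrite /c /z sin2cos2.
transitivity ((C ^+ 2 + S ^+ 2) * (c ^+ 2 - 2 * c + 1 + z ^+ 2)); first by ring.
by rewrite cz; ring.
Qed.

End Weights.

Section Spectral.
Context {R : realType}.
Variables (L : (int -> R) -> R) (b : int -> R).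
Hypothesis mL : is_mean L.
Hypothesis bb : bdd b.

Lemma mean_sum (I : Type) (r : seq I) (f : I -> int -> R) : (forall i, bdd (f i)) ->
  L (fun x => \sum_(i <- r) f i x) = \sum_(i <- r) L (f i).
Proof.
move=> h; elim: r => [|i r IH].
  by under eq_fun do rewrite big_nil; rewrite big_nil (mean_cst mL).
under eq_fun do rewrite big_cons.
by rewrite big_cons (meanD mL) ?IH//; exact: bdd_sum.
Qed.

Definition correlation (n : int) : R := L (fun x => b x * b (x + n)).

Lemma bdd_correlation m n : bdd (fun x => b (x + m) * b (x + n)).
Proof. by apply: bddM; [exact: (bdd_comp (fun x => x + m) bb)|exact: (bdd_comp (fun x => x + n) bb)]. Qed.

Lemma mean_conv_sqr s : L (fun x => conv s b x ^+ 2) =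
  \sum_(p <- s) \sum_(q <- s) p.1 * q.1 * correlation (p.2 - q.2).
Proof.
have -> : (fun x => conv s b x ^+ 2) = (fun x =>
    \sum_(p <- s) \sum_(q <- s) p.1 * q.1 * (b (x + - p.2) * b (x + - q.2))).
  apply/funext => x; rewrite expr2 /conv mulr_suml; apply: eq_bigr => p _.
  by rewrite mulr_sumr; apply: eq_bigr => q _; ring.
have h (p q : R * int) : bdd (fun x => p.1 * q.1 * (b (x + - p.2) * b (x + - q.2))).
  by apply: bddM; [exact: bdd_cst|exact: bdd_correlation].
rewrite mean_sum; last by move=> p; exact: bdd_sum.
apply: eq_bigr => p _; rewrite mean_sum//; apply: eq_bigr => q _.
rewrite (meanZ mL); last exact: bdd_correlation.
congr (_ * _); rewrite -(mean_shift mL p.2); last exact: bdd_correlation.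
by rewrite /correlation; congr L; apply/funext => x; congr (b _ * b _); ring.
Qed.

Lemma correlation_even n : correlation (- n) = correlation n.
Proof.
rewrite /correlation -(mean_shift mL n).
  by congr L; apply/funext => x; rewrite addrK mulrC.
by apply: bddM => //; exact: (bdd_comp (fun x => x - n) bb).
Qed.

(** The quadratic form is the mean of the square of the convolution with masses [c i] at [i]. *)
Lemma correlation_posdef : posdef correlation.
Proof.
move=> n c.
have := mean_conv_sqr [seq (c (val i), (val i)%:Z) | i : 'I_n].
rewrite big_map big_enum /=.
under eq_bigr do rewrite big_map big_enum /=.
move=> <-; rewrite -(mean_cst mL 0); apply: (le_mean mL).
- exact: bdd_cst.
- by under eq_fun do rewrite expr2; apply: bddM; exact: bdd_conv.
- by move=> x; exact: sqr_ge0.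
Qed.

Lemma spectral_measure : 0 < correlation 0 ->
  exists G : R -> R, [/\ {homo G : x y / x <= y},
    forall t, 0 <= G t <= pi *+ 2 &
    forall s, L (fun x => conv s b x ^+ 2) =
      correlation 0 * I01 (fun t => power s (G t))].
Proof.
(* Herglotz is stated for [g 0 = 1]; the normalising factor [correlation 0] returns in the
   conclusion. *)
move=> c0; pose g n := (correlation 0)^-1 * correlation n.
have [|n||G [nG G2 GE]] := @herglotz R g.
- move=> n c; have := @correlation_posdef n c.
  rewrite -(pmulr_rge0 _ (_ : 0 < (correlation 0)^-1)) ?invr_gt0// mulr_sumr.
  rewrite (eq_bigr (fun i : 'I_n => \sum_(j < n) c i * c j * g (i%:Z - j%:Z)))//.
  by move=> i _; rewrite mulr_sumr; apply: eq_bigr => j _; rewrite /g mulrCA.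
- by rewrite /g correlation_even.
- by rewrite /g mulVf// gt_eqF.
exists G; split => // s.
have mG := nondecreasing_measurable nG.
rewrite mean_conv_sqr; under [in RHS]eq_fun do rewrite powerE.
have bc (p q : R * int) : bdd_meas (fun t => p.1 * q.1 * cos ((p.2 - q.2)%:~R * G t)).
  by apply: bdd_measZ; exact: bdd_meas_cos.
rewrite I01_sum; last by move=> p; exact: bdd_meas_sum.
rewrite mulr_sumr; apply: eq_bigr => p _; rewrite I01_sum// mulr_sumr.
apply: eq_bigr => q _; rewrite I01Z; last exact: bdd_meas_cos.
by rewrite GE /g; field; rewrite gt_eqF.
Qed.

End Spectral.

(** * Equidistributed weights *)

Section Equidistribution.
Context {R : realType}.
Variables (G : R -> R) (W : nat -> seq (R * int)).
Hypothesis G_homo : {homo G : x y / x <= y}.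
Hypothesis G_2pi : forall s, 0 <= G s <= pi *+ 2.
Hypothesis W_weight : forall j, weight (W j).
Hypothesis W_equid : forall t, 0 < t < pi *+ 2 -> (fun j => power (W j) t) @ \oo --> 0.

Let mG : measurable_fun setT G := nondecreasing_measurable G_homo.

Definition off (F : seq R) : set R := [set s | G s \notin F].

Lemma measurable_off F : measurable (off F).
Proof.
have mF : measurable [set x : R | x \in F].
  elim: F => [|a F IH].
    by rewrite (_ : mkset _ = set0)//; apply/seteqP; split.
  rewrite (_ : mkset _ = [set a] `|` [set x | x \in F]).
    by apply: measurableU.
  apply/seteqP; split => x /=; rewrite inE.
    by case/orP => [/eqP ->|xF]; [left|right].
  by case => [->|->]; rewrite ?eqxx ?orbT.
have := mG measurableT (measurableC mF); rewrite setTI.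
by rewrite (_ : _ @^-1` _ = off F)//; apply/seteqP; split => x /= /negP.
Qed.

Lemma power_weight_norm j t : `|power (W j) t| <= 1.
Proof. by rewrite ger0_norm ?power_ge0// power_le1. Qed.

Lemma W_equid_norm t : 0 < `|t| < pi *+ 2 -> (fun j => power (W j) t) @ \oo --> 0.
Proof.
case: (ger0P t) => [_ /W_equid//|_ /W_equid].
by under eq_fun do rewrite powerN.
Qed.

Lemma bdd_meas_power_shift F (a : R) s :
  bdd_meas (fun t => \1_(off F) t * power s (G t - a)).
Proof.
apply: bdd_measM; first by apply: bdd_meas_indic; exact: measurable_off.
apply: (@bdd_meas_power _ _ (fun t => G t - a)).
by apply: measurable_funB => //; exact: measurable_cst.
Qed.

(** Evenness of [power] extends equidistribution from frequencies in [(0, 2 pi)] to signed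
    differences; dominated convergence then applies. *)
Lemma cvg_power_shift F (a : R) : (forall s, off F s -> 0 < `|G s - a| < pi *+ 2) ->
  (fun j => I01 (fun s => \1_(off F) s * power (W j) (G s - a))) @ \oo --> 0.
Proof.
move=> h; rewrite -(I01_cst 0).
apply: (@I01_dct _ _ (fun=> 0) 1).
- by move=> j; exact: bdd_meas_power_shift.
- exact: bdd_meas_cst.
- move=> j s; rewrite normrM -[leRHS]mulr1 ler_pM// ?power_weight_norm//.
  by rewrite indicE ger0_norm// lern1 leq_b1.
- move=> s; rewrite indicE; case: (pselect (off F s)) => sF.
    by rewrite mem_set//; under eq_fun do rewrite mul1r; apply: W_equid_norm; exact: h.
  by rewrite memNset//; under eq_fun do rewrite mul0r; exact: cvg_cst.
Qed.

Lemma power_le_atom F j (a s : R) :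
  power (W j) (G s - a) <= \1_(~` off F) s + \1_(off F) s * power (W j) (G s - a).
Proof.
rewrite !indicE in_setC; case: (s \in off F) => /=; first by rewrite add0r mul1r.
by rewrite mul0r addr0 power_le1.
Qed.

(** Both 0 and [2 pi] are removed because [G] maps into the closed interval and both ends represent
    the trivial frequency. *)
Lemma power_integral_near_atom (e : R) : 0 < e ->
  \forall j \near \oo, I01 (fun s => power (W j) (G s)) <=
    I01 \1_(~` off [:: 0; pi *+ 2]) + e.
Proof.
move=> e0; have h s : off [:: 0; pi *+ 2] s -> 0 < `|G s - 0| < pi *+ 2.
  rewrite /off /= !inE negb_or subr0 => /andP[s0 s1].
  have /andP[g0 g1] := G_2pi s.
  by rewrite ger0_norm// !lt_neqAle g0 g1 eq_sym s0 s1.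
have /cvgr0_norm_le/(_ e e0) := cvg_power_shift h.
apply: filterS => j /ler_normlW => hj.
have b1 : bdd_meas (\1_(~` off [:: 0; pi *+ 2]) : R -> R).
  by apply: bdd_meas_indic; apply: measurableC; exact: measurable_off.
have b2 := bdd_meas_power_shift [:: 0; pi *+ 2] 0 (W j).
apply: (@le_trans _ _ (I01 (fun s => \1_(~` off [:: 0; pi *+ 2]) s +
    \1_(off [:: 0; pi *+ 2]) s * power (W j) (G s - 0)))).
  apply: le_I01; [exact: bdd_meas_power|exact: bdd_measD|].
  by move=> s _; rewrite -[G s in leLHS]subr0; exact: power_le_atom.
by rewrite I01D// lerD2l.
Qed.

Section NonatomicPart.
Variables (F : seq R) (kappa : R).
Hypothesis F0 : 0 \in F.
Hypothesis F2pi : pi *+ 2 \in F.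
Hypothesis kappa0 : 0 < kappa.
Hypothesis level_le : forall s, 0 <= s <= 1 -> off F s ->
  I01 \1_[set t | G t = G s] <= kappa.

Lemma off_lt s : off F s -> 0 < G s < pi *+ 2.
Proof.
move=> sF; have /andP[g0 g1] := G_2pi s; rewrite !lt_neqAle g0 g1 !andbT.
by apply/andP; split; apply: contraNneq sF; [move=> <-|move=> ->].
Qed.

Let C (k : int) : R := I01 (fun s => \1_(off F) s * cos (k%:~R * G s)).
Let S (k : int) : R := I01 (fun s => \1_(off F) s * sin (k%:~R * G s)).

Let b1 : bdd_meas (\1_(off F) : R -> R) := bdd_meas_indic (measurable_off F).
Let bC (k : int) : bdd_meas (fun s => \1_(off F) s * cos (k%:~R * G s)) := bdd_measM b1 (bdd_meas_cos _ mG).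
Let bS (k : int) : bdd_meas (fun s => \1_(off F) s * sin (k%:~R * G s)) := bdd_measM b1 (bdd_meas_sin _ mG).

(** The inner integral of [power] over pairs of frequencies. Its finite expansion [hE] lets the
    outer integral be computed term by term in [I01_h], where the squared Fourier coefficients
    [C ^+ 2 + S ^+ 2] appear. *)
Let h s a : R := I01 (fun t => \1_(off F) t * power s (G t - a)).

Let hE s a : h s a = \sum_(p <- s) \sum_(q <- s) p.1 * q.1 *
  (cos ((p.2 - q.2)%:~R * a) * C (p.2 - q.2) + sin ((p.2 - q.2)%:~R * a) * S (p.2 - q.2)).
Proof.
pose f (p q : R * int) (t : R) := p.1 * q.1 *
  (cos ((p.2 - q.2)%:~R * a) * (\1_(off F) t * cos ((p.2 - q.2)%:~R * G t)) +
   sin ((p.2 - q.2)%:~R * a) * (\1_(off F) t * sin ((p.2 - q.2)%:~R * G t))).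
have bf p q : bdd_meas (f p q).
  by apply: bdd_measZ; apply: bdd_measD; apply: bdd_measZ; [exact: bC|exact: bS].
rewrite /h (eq_I01 (g := fun t => \sum_(p <- s) \sum_(q <- s) f p q t)).
  rewrite I01_sum; last by move=> p; exact: bdd_meas_sum.
  apply: eq_bigr => p _; rewrite I01_sum//; apply: eq_bigr => q _.
  rewrite /f I01Z; last by apply: bdd_measD; apply: bdd_measZ; [exact: bC|exact: bS].
  rewrite I01D; [|by apply: bdd_measZ; exact: bC|by apply: bdd_measZ; exact: bS].
  by rewrite !I01Z.
move=> t _; rewrite powerE mulr_sumr; apply: eq_bigr => p _.
rewrite mulr_sumr; apply: eq_bigr => q _.
by rewrite /f mulrBr cosB; ring.
Qed.

Let bh s : bdd_meas (fun a => h s (G a)).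
Proof.
under eq_fun do rewrite hE.
apply: bdd_meas_sum => p; apply: bdd_meas_sum => q; apply: bdd_measZ; apply: bdd_measD.
  by apply: bdd_measM; [exact: bdd_meas_cos|exact: bdd_meas_cst].
by apply: bdd_measM; [exact: bdd_meas_sin|exact: bdd_meas_cst].
Qed.

Let I01_h s : I01 (fun a => \1_(off F) a * h s (G a)) =
  \sum_(p <- s) \sum_(q <- s) p.1 * q.1 * (C (p.2 - q.2) ^+ 2 + S (p.2 - q.2) ^+ 2).
Proof.
pose f (p q : R * int) (t : R) := p.1 * q.1 *
  (C (p.2 - q.2) * (\1_(off F) t * cos ((p.2 - q.2)%:~R * G t)) +
   S (p.2 - q.2) * (\1_(off F) t * sin ((p.2 - q.2)%:~R * G t))).
have bf p q : bdd_meas (f p q).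
  by apply: bdd_measZ; apply: bdd_measD; apply: bdd_measZ; [exact: bC|exact: bS].
rewrite (eq_I01 (g := fun t => \sum_(p <- s) \sum_(q <- s) f p q t)).
  rewrite I01_sum; last by move=> p; exact: bdd_meas_sum.
  apply: eq_bigr => p _; rewrite I01_sum//; apply: eq_bigr => q _.
  rewrite /f I01Z; last by apply: bdd_measD; apply: bdd_measZ; [exact: bC|exact: bS].
  rewrite I01D; [|by apply: bdd_measZ; exact: bC|by apply: bdd_measZ; exact: bS].
  by rewrite !I01Z.
move=> t _; rewrite hE mulr_sumr; apply: eq_bigr => p _.
rewrite mulr_sumr; apply: eq_bigr => q _.
by rewrite /f; ring.
Qed.

Let h_bound j a : 0 <= h (W j) a <= 1.
Proof.
rewrite -(I01_cst 0) -(I01_cst 1); apply/andP; split.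
  apply: le_I01; [exact: bdd_meas_cst|exact: bdd_meas_power_shift|].
  by move=> s _; rewrite mulr_ge0 ?power_ge0// indicE.
apply: le_I01; [exact: bdd_meas_power_shift|exact: bdd_meas_cst|].
by move=> s _; rewrite indicE mulr_ile1// ?power_ge0 ?power_le1// lern1 leq_b1.
Qed.

(** For a fixed [a] the integrand tends to 0 except where [G t = G a], and this level set has
    measure at most [kappa]. *)
Let h_near a (e : R) : 0 < e -> 0 <= a <= 1 -> off F a ->
  \forall j \near \oo, h (W j) (G a) <= kappa + e.
Proof.
move=> e0 a01 aF; have /andP[a0 a2] := off_lt aF.
pose F' := G a :: F.
have hF s : off F' s -> 0 < `|G s - G a| < pi *+ 2.
  rewrite /off /= inE negb_or => /andP[sa sF]; have /andP[s0 s2] := off_lt sF.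
  rewrite normr_gt0 subr_eq0 sa /= ltr_norml.
  by apply/andP; split; lra.
have /cvgr0_norm_le/(_ e e0) := cvg_power_shift hF.
apply: filterS => j /ler_normlW hj.
have ml : measurable [set t | G t = G a].
  by have := mG measurableT (measurable_set1 (G a)); rewrite setTI.
apply: (@le_trans _ _ (I01 (fun s => \1_[set t | G t = G a] s +
    \1_(off F') s * power (W j) (G s - G a)))).
  apply: le_I01; [exact: bdd_meas_power_shift|apply: bdd_measD; [exact: bdd_meas_indic|exact: bdd_meas_power_shift]|].
  move=> s _; rewrite !indicE.
  case: (pselect (G s = G a)) => sa.
    rewrite [in leRHS]mem_set//= (@le_trans _ _ 1)//.
      by rewrite mulr_ile1// ?power_ge0 ?power_le1// lern1 leq_b1.
    by rewrite lerDl mulr_ge0// power_ge0.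
  rewrite [s \in [set t | G t = G a]]memNset// add0r ler_wpM2r ?power_ge0// ler_nat.
  rewrite leq_eqVlt; apply/orP; left; apply/eqP; congr nat_of_bool.
  apply/idP/idP => /set_mem => sF; apply: mem_set.
    by rewrite /off /= inE negb_or sF andbT; apply/eqP.
  by move: sF; rewrite /off /= inE negb_or => /andP[].
rewrite I01D; [|exact: bdd_meas_indic|exact: bdd_meas_power_shift].
by apply: lerD => //; exact: level_le.
Qed.

Let I01_h_near : \forall j \near \oo,
  I01 (fun a => \1_(off F) a * h (W j) (G a)) <= kappa *+ 2.
Proof.
(* [h (W j) (G a)] is only known to be eventually below [kappa + e], so dominated convergence is
   applied to its excess over [kappa]. The indicator of [[0, 1]] is there because [level_le] covers
   these parameters only, while [I01_dct] asks for convergence everywhere. *)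
pose v j a : R := \1_(off F) a * \1_`[0, 1]%classic a * Num.max (h (W j) (G a) - kappa) 0.
have bv j : bdd_meas (v j).
  apply: bdd_measM; first by apply: bdd_measM => //; exact: bdd_meas_indic.
  split.
    apply: measurable_maxr; last exact: measurable_cst.
    by apply: measurable_funB; [exact: (bh _).1|exact: measurable_cst].
  exists 1 => a; have /andP[h0 h1] := h_bound j (G a).
  by rewrite ger0_norm ?le_max ?lexx ?orbT// ge_max ler01 andbT lerBlDr (le_trans h1)// lerDl ltW.
have v0 : (fun j => I01 (v j)) @ \oo --> 0.
  rewrite -(I01_cst 0); apply: (@I01_dct _ _ (fun=> 0) 1) => //; first exact: bdd_meas_cst.
    move=> j a; have /andP[h0 h1] := h_bound j (G a).
    rewrite /v ger0_norm; last by rewrite !mulr_ge0// ?indicE// le_max lexx orbT.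
    rewrite mulr_ile1 ?mulr_ge0 ?indicE// ?le_max ?lexx ?orbT//.
      by rewrite -natrM lern1; case: (_ \in _); case: (_ \in _).
    by rewrite ge_max ler01 andbT lerBlDr (le_trans h1)// lerDl ltW.
  move=> a; rewrite /v !indicE; case: (pselect (off F a)) => aF; last first.
    by rewrite memNset//; under eq_fun do rewrite !mul0r; exact: cvg_cst.
  case: (pselect (0 <= a <= 1)) => a01; last first.
    rewrite [a \in `[0, 1]%classic]memNset; last by rewrite /= in_itv.
    by under eq_fun do rewrite mulr0 mul0r; exact: cvg_cst.
  apply/cvgr0Pnorm_le => e e0; have := h_near e0 a01 aF.
  apply: filterS => j hj; rewrite !mem_set//= !mul1r.
  by rewrite ger0_norm ?le_max ?lexx ?orbT// ge_max (ltW e0) andbT; lra.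
have /cvgr0_norm_le/(_ kappa kappa0) := v0.
apply: filterS => j /ler_normlW hj.
apply: (@le_trans _ _ (I01 (fun a => kappa + v j a))); last first.
  by rewrite I01D// ?I01_cst ?mulr2n ?lerD2l//; exact: bdd_meas_cst.
apply: le_I01; [exact: bdd_measM|by apply: bdd_measD => //; exact: bdd_meas_cst|].
move=> a a01; rewrite /v !indicE [a \in `[0, 1]%classic]mem_set//= mulr1.
case: (a \in off F); rewrite ?mul0r ?addr0 ?(ltW kappa0)// !mul1r.
by rewrite -lerBlDl le_max lexx.
Qed.

(* Cauchy-Schwarz, in the form [x <= tau + x ^+ 2 / tau], bounds the left-hand
   side by the average of the squared Fourier coefficients of the restriction of
   the spectral measure to the complement of [F]; this average is an integral of
   [power (W j)] over differences of pairs of points, hence small by equidistribution. *)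
Lemma power_filter_off_near (tau : R) : 0 < tau ->
  \forall j \near \oo, forall P : pred (R * int),
    I01 (fun s => \1_(off F) s * power (seq.filter P (W j)) (G s)) <= tau + kappa *+ 2 / tau.
Proof.
move=> tau0; have := I01_h_near; apply: filterS => j hj P.
set V := seq.filter P (W j); have wV : weight V by exact: weight_filter.
have -> : I01 (fun s => \1_(off F) s * power V (G s)) =
    \sum_(p <- V) \sum_(q <- V) p.1 * q.1 * C (p.2 - q.2).
  have := hE V 0; rewrite /h.
  under eq_fun do rewrite subr0.
  move=> ->; apply: eq_bigr => p _; apply: eq_bigr => q _.
  by rewrite mulr0 cos0 sin0 mul1r mul0r addr0.
apply: (@le_trans _ _ (\sum_(p <- V) \sum_(q <- V) p.1 * q.1 * tau +
   (\sum_(p <- V) \sum_(q <- V) p.1 * q.1 * (C (p.2 - q.2) ^+ 2 + S (p.2 - q.2) ^+ 2)) / tau)).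
  rewrite mulr_suml -big_split big_seq [leRHS]big_seq; apply: ler_sum => p pV /=.
  rewrite mulr_suml -big_split big_seq [leRHS]big_seq; apply: ler_sum => q qV /=.
  set c := C _; set z := S _.
  rewrite -[X in _ + X]mulrA -mulrDr ler_wpM2l ?mulr_ge0 ?wV.1//.
  rewrite -(ler_pM2r tau0) mulrDl divfK ?gt_eqF//.
  by have := sqr_ge0 (c - tau); have := sqr_ge0 z; nra.
apply: lerD; first by apply: le_weight_sum2 => //; exact: ltW.
rewrite ler_pM2r ?invr_gt0//; apply: le_trans hj; rewrite I01_h.
(* All terms are nonnegative, so enlarging the sub-weight to [W j] only increases the sum; hence the
   bound is uniform in [P]. *)
have nn p q : p \in W j -> q \in W j ->
    0 <= p.1 * q.1 * (C (p.2 - q.2) ^+ 2 + S (p.2 - q.2) ^+ 2).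
  move=> pW qW; rewrite mulr_ge0 ?addr_ge0 ?sqr_ge0// mulr_ge0//; exact: (W_weight j).1.
rewrite /V big_filter big_mkcond big_seq [leRHS]big_seq; apply: ler_sum => p pW.
rewrite big_filter big_mkcond big_seq [leRHS]big_seq.
case: ifP => _; last by apply: sumr_ge0 => q qW; exact: nn.
by apply: ler_sum => q qW; case: ifP => // _; exact: nn.
Qed.

End NonatomicPart.

(* [G] is monotone, so a value taken on a set of measure more than [1 / N] is
   taken at some [i / N]: outside this list the spectral measure has small atoms. *)
Definition level_grid (N : nat) : seq R :=
  0 :: pi *+ 2 :: [seq G (i%:R / N%:R) | i <- iota 0 N.+2].

Lemma level_grid_le (N : nat) s : (0 < N)%N -> 0 <= s <= 1 -> off (level_grid N) s ->
  I01 \1_[set t | G t = G s] <= N%:R^-1.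
Proof.
move=> N0 /andP[s0 s1] sF; have NR : (0 : R) < N%:R by rewrite ltr0n.
have ng i : (i < N.+2)%N -> G s != G (i%:R / N%:R).
  move=> iN; apply: contraNneq sF => ->; rewrite /level_grid in_cons in_cons.
  apply/orP; right; apply/orP; right; apply: map_f.
  by rewrite mem_iota.
(* The level set avoids the sample points, so it lies within the cell of [s]. For [s = 1] this cell
   is [[1, (N + 1) / N]], which is why [level_grid] has [N.+2] samples. *)
pose i := Num.truncn (s * N%:R).
have isN : i%:R <= s * N%:R by rewrite truncn_le mulr_ge0.
have iN : (i < N.+1)%N by rewrite ltnS -(ler_nat R) (le_trans isN)// ler_piMl.
have l1 : i%:R / N%:R <= s by rewrite ler_pdivrMr.
have l2 : s <= i.+1%:R / N%:R by rewrite ler_pdivlMr//; exact/ltW/truncnS_gt.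
have -> : N%:R^-1 = i.+1%:R / N%:R - i%:R / N%:R :> R.
  by rewrite -mulrBl -natrB// subSnn mul1r.
apply: le_I01_indic.
- by have := mG measurableT (measurable_set1 (G s)); rewrite setTI.
- by rewrite ler_pM2r ?invr_gt0// ler_nat.
- move=> t /= ts; rewrite in_itv /=; apply/andP; split.
    rewrite leNgt; apply/negP => /ltW/G_homo; rewrite ts => h1.
    have /eqP := ng i (ltnW iN); apply; apply/eqP; rewrite eq_le h1.
    exact: G_homo.
  rewrite leNgt; apply/negP => /ltW/G_homo; rewrite ts => h1.
  have /eqP := ng i.+1 iN; apply; apply/eqP; rewrite eq_le h1 andbT.
  exact: G_homo.
Qed.

End Equidistribution.

(** * Finite truncations of the averaging measures *)

Section Truncation.
Context {R : realType}.

Section OneMeasure.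
Variable mu : probability int R.
Implicit Types (A E : set int) (f : int -> R).

Let mass A : R := fine (mu A).

Let massE A : mu A = (mass A)%:E.
Proof. by rewrite /mass fineK// fin_num_measure. Qed.

Lemma integrable_int E f : bdd f -> mu.-integrable E (EFin \o f).
Proof.
move=> [C hC]; apply: measurable_bounded_integrable => //.
  by apply: le_lt_trans (probability_le1 mu _) _ => //; rewrite ltry.
by exists C; split; [exact: num_real|] => x Cx y _ /=; apply: (le_trans (hC y)); exact: ltW.
Qed.

Lemma Rintegral_seq (r : seq int) f : uniq r -> bdd f ->
  \int[mu]_(x in [set` r]) f x = \sum_(n <- r) mass [set n] * f n.
Proof.
move=> + bf; elim: r => [_|n r IH /= /andP[nr ur]].
  by rewrite big_nil (_ : [set` _] = set0) ?Rintegral_set0//; apply/seteqP; split.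
rewrite big_cons -IH// (_ : [set` _] = [set n] `|` [set` r]); last first.
  apply/seteqP; split => x /=; rewrite inE.
    by case/orP => [/eqP ->|xr]; [left|right].
  by case => [->|->]; rewrite ?eqxx ?orbT.
rewrite Rintegral_setU//; last 2 first.
- exact: integrable_int.
- apply/disj_setPS => x /= [-> h]; by rewrite h in nr.
congr (_ + _); rewrite (@eq_Rintegral _ _ _ _ _ (cst (f n))); last first.
  by move=> x /set_mem /= ->.
by rewrite Rintegral_cst// mulrC.
Qed.

Lemma Rintegral_seq_error (r : seq int) f e : uniq r -> bdd f ->
  (forall x, `|f x| <= 1) -> mass (~` [set` r]) <= e ->
  `|\int[mu]_x f x - \sum_(n <- r) mass [set n] * f n| <= e.
Proof.
move=> ur bf f1 re; rewrite -Rintegral_seq// -(setUv [set` r]) Rintegral_setU//; last 2 first.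
- exact: integrable_int.
- by apply/disj_setPS; rewrite setICr.
rewrite addrC addKr; apply: le_trans re.
apply: (le_trans (le_normr_Rintegral _ _)) => //; first exact: integrable_int.
have -> : mass (~` [set` r]) = \int[mu]_(x in ~` [set` r]) (1 : R).
  by rewrite Rintegral_cst// mul1r.
apply: le_Rintegral => //; last exact: (integrable_int _ (bdd_cst 1)).
by apply: (@integrable_int _ (fun x => `|f x|)); exists 1 => x; rewrite normr_id.
Qed.

(** The integers are exhausted by the finite sets of elements with code below [K]; continuity from
    below makes the remaining mass small. *)
Lemma exists_truncation (e : R) : 0 < e ->
  exists2 r : seq int, uniq r & mass (~` [set` r]) <= e.
Proof.
move=> e0; pose r K := undup (pmap (@pickle_inv int) (iota 0 K)).
have rP K n : (n \in r K) = (choice.pickle n < K)%N.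
  rewrite mem_undup mem_pmap; apply/mapP/idP => [[i + +]|nK].
    rewrite mem_iota /= add0n => iK h; have := @pickle_invK int i.
    by rewrite -h /= => ->.
  by exists (choice.pickle n); rewrite ?mem_iota//= pickleK_inv.
have ndr : nondecreasing_seq (fun K => [set` r K]).
  move=> K K' KK; apply/subsetPset => n /=; rewrite !rP => h.
  exact: leq_trans h KK.
have rT : \bigcup_K [set` r K] = setT.
  by apply/seteqP; split => // n _; exists (choice.pickle n).+1 => //=; rewrite rP.
have : (fun K => mu [set` r K]) @ \oo --> mu (\bigcup_K [set` r K]).
  exact: (nondecreasing_cvg_mu (mu := mu) (fun i => I) I ndr).
rewrite rT probability_setT => /fine_cvg /cvgrPdist_le/(_ e e0)[K _ /(_ K (leqnn _)) /= h].
exists (r K); first exact: undup_uniq.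
rewrite /mass probability_setC// massE -EFinB /=.
by apply: le_trans h; exact: ler_norm.
Qed.

End OneMeasure.

Lemma Im_normc (z : R[i]) : `|complex.Im z|%:C <= `|z|.
Proof.
case: z => x y; rewrite normc_def lecR /= -sqrtr_sqr.
by apply: ler_wsqrtr; rewrite lerDr sqr_ge0.
Qed.

(** [W j] lists the point masses of [nu j] on a finite set that misses at most [1 / (j + 1)] of the
    mass. This error tends to 0, so the transforms still do. *)
Lemma equidistributed_truncation (nu : nat -> probability int R) :
  equidistributed nu ->
  exists W : nat -> seq (R * int), [/\ forall j, weight (W j),
    forall t, 0 < t < pi *+ 2 -> (fun j => power (W j) t) @ \oo --> 0,
    (fun j => \sum_(p <- W j) p.1) @ \oo --> (1 : R) &
    forall A j, fine (nu j A) - j.+1%:R^-1 <= \sum_(p <- W j | p.2 \in A) p.1].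
Proof.
move=> eq_nu; have e0 j : (0 : R) < j.+1%:R^-1 by rewrite invr_gt0.
have /choice[r rP] : forall j, exists r : seq int,
    uniq r /\ fine (nu j (~` [set` r])) <= j.+1%:R^-1.
  by move=> j; have [r] := exists_truncation (nu j) (e0 j); exists r.
have ur j := (rP j).1; have re j := (rP j).2.
pose W j : seq (R * int) := [seq (fine (nu j [set n]), n) | n <- r j].
have WE j (f : int -> R) : \sum_(p <- W j) p.1 * f p.2 = \sum_(n <- r j) fine (nu j [set n]) * f n.
  by rewrite big_map.
have WA j (A : set int) : \sum_(p <- W j | p.2 \in A) p.1 = fine (nu j (A `&` [set` r j])).
  transitivity (\sum_(p <- W j) p.1 * \1_A p.2).
    rewrite big_mkcond; apply: eq_bigr => p _; rewrite indicE.
    by case: (p.2 \in A); rewrite ?mulr1 ?mulr0.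
  by rewrite WE -Rintegral_seq//; [rewrite /Rintegral integral_indic|exact: bdd_indic].
have mass_split j A : fine (nu j A) <= fine (nu j (A `&` [set` r j])) + j.+1%:R^-1.
  apply: le_trans (_ : _ <= fine (nu j (A `&` [set` r j])) + fine (nu j (~` [set` r j]))) _; last by rewrite lerD2l.
  rewrite -fineD ?fin_num_measure// fine_le ?fin_numD ?fin_num_measure//.
  apply: (@le_trans _ _ (nu j ((A `&` [set` r j]) `|` ~` [set` r j]))).
    apply: le_measure; [exact: mem_set|exact: mem_set|].
    by move=> x Ax; case: (pselect ([set` r j] x)) => h; [left|right].
  by apply: measureU2.
have m1 j : \sum_(p <- W j) p.1 = fine (nu j [set` r j]).
  by rewrite -[X in nu j X]setTI -WA; apply: eq_bigl => p; rewrite in_setT.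
exists W; split.
- move=> j; split; first by move=> p /mapP[n _ ->]; exact: fine_ge0.
  rewrite m1 -[leRHS]/(fine 1%E) fine_le ?fin_num_measure//.
  exact: probability_le1.
- move=> t t02.
  have {eq_nu} : (fun j => cintegral (nu j) (fun n => expi (n%:~R * t)) : R[i]^o) @ \oo
      --> (0 : R[i]^o) by apply: eq_nu; rewrite mulr_natl.
  move=> /cvgr0_norm_le eq_nu.
  have conv0 (f : int -> R) : (forall n, `|f n| <= 1) ->
      (forall e : R, 0 < e -> \forall j \near \oo, `|\int[nu j]_x f x| <= e) ->
      (fun j => \sum_(p <- W j) p.1 * f p.2) @ \oo --> 0.
    move=> f1 h; apply/cvgr0Pnorm_le => e ep.
    have e2 : 0 < e / 2 by rewrite divr_gt0.
    near=> j; rewrite WE.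
    have h1 : `|\int[nu j]_x f x| <= e / 2 by near: j; exact: h.
    have h2 : j.+1%:R^-1 <= e / 2.
      near: j; have /cvgr0_norm_le/(_ _ e2) := @cvg_harmonic R.
      by apply: filterS => j /ler_normlW.
    have bf : bdd f by exists 1.
    have := le_trans (Rintegral_seq_error (ur j) bf f1 (re j)) h2.
    move: h1; set x := Rintegral _ _ _; set y := \sum_(n <- _) _ => h1 h3.
    have := ler_normB x (x - y); rewrite opprB addrCA subrr addr0 => h4.
    by apply: (le_trans h4); rewrite [leRHS]splitr lerD.
  have cs : (fun j => \sum_(p <- W j) p.1 * cos (p.2%:~R * t)) @ \oo --> 0.
    apply: (conv0 (fun n => cos (n%:~R * t))) => [n|e ep]; first exact: cos_max.
    have := eq_nu e%:C; rewrite ltcR => /(_ ep); apply: filterS => j h.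
    by rewrite -lecR; apply: le_trans h; exact: (normc_ge_Re (cintegral (nu j) (fun n => expi (n%:~R * t)))).
  have sn : (fun j => \sum_(p <- W j) p.1 * sin (p.2%:~R * t)) @ \oo --> 0.
    apply: (conv0 (fun n => sin (n%:~R * t))) => [n|e ep]; first exact: sin_max.
    have := eq_nu e%:C; rewrite ltcR => /(_ ep); apply: filterS => j h.
    by rewrite -lecR; apply: le_trans h; exact: (Im_normc (cintegral (nu j) (fun n => expi (n%:~R * t)))).
  have -> : (0 : R) = 0 * 0 + 0 * 0 by rewrite mulr0 addr0.
  exact: (cvgD (cvgM cs cs) (cvgM sn sn)).
- apply: (@squeeze_cvgr _ _ _ _ (fun j => 1 - j.+1%:R^-1) (fun=> 1)).
  + apply: nearW => j; rewrite m1; apply/andP; split.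
      by have := mass_split j setT; rewrite probability_setT setTI /= -lerBlDr.
    rewrite -[leRHS]/(fine 1%E) fine_le ?fin_num_measure//.
    exact: probability_le1.
  + rewrite -[X in _ --> X]subr0; apply: cvgB; [exact: cvg_cst|exact: cvg_harmonic].
  + exact: cvg_cst.
- by move=> A j; rewrite WA lerBlDr.
Unshelve. all: by end_near. Qed.

End Truncation.

(** * Bohr sets and the main estimate *)

Section BohrSets.
Context {R : realType}.
Implicit Types (F : seq R).

(** One sum over all frequencies, instead of one condition for each, makes the set exactly the
    positivity set of the real part of a single trigonometric polynomial. *)
Definition bohr_nbhs F (rho : R) : set int :=
  [set d | \sum_(t <- F) (1 - cos (t * d%:~R)) < rho].

Lemma bohr_nbhs_is_bohr F (rho : R) : 0 < rho -> is_bohr R (bohr_nbhs F rho).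
Proof.
move=> rho0.
pose lam (i : 'I_(size F).+1) : R := nth 0 (0 :: F) i.
(* The constant term [rho - size F], at frequency 0, absorbs the ones in the terms [1 - cos]. *)
pose c (i : 'I_(size F).+1) : R[i] := if i == ord0 then (rho - (size F)%:R)%:C else 1.
have ReD : {morph (@complex.Re R) : x y / x + y >-> x + y} by case=> x1 y1 [x2 y2].
have ReE n : complex.Re (trig_poly c lam n) = rho - \sum_(t <- F) (1 - cos (t * n%:~R)).
  rewrite /trig_poly (big_morph _ ReD (erefl _)).
  rewrite big_ord_recl /= /lam /= mul0r cos0 sin0 mulr1 mulr0 subr0.
  rewrite [in RHS]sumrB big_const_seq count_predT iter_addr_0 opprB [in RHS]addrA [in RHS]addrAC (big_nth 0) big_mkord.
  by congr (_ + _); apply: eq_bigr => i _; rewrite mul1r mul0r subr0.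
exists (size F).+1, c, lam; split => [|n /=]; last by rewrite ReE subr_gt0.
exists 0; rewrite /= ReE big1 ?subr0// => t _.
by rewrite mulr0 cos0 subrr.
Qed.

(* Along an ultrafilter the points [(cos (n t), sin (n t))] converge, so two
   integers close to the limit differ by an almost period. *)
Lemma bohr_nbhs_recurrent F (rho : R) : 0 < rho ->
  exists2 d : nat, (0 < d)%N & bohr_nbhs F rho d%:Z.
Proof.
move=> rho0; have [U [UU hU]] := nat_ultrafilter.
have cc (t : R) : (fun n : nat => cos (t * n%:R)) @ U --> lim ((fun n : nat => cos (t * n%:R)) @ U).
  by apply: ultra_cvg; exists 1 => n; exact: cos_max.
have cs (t : R) : (fun n : nat => sin (t * n%:R)) @ U --> lim ((fun n : nat => sin (t * n%:R)) @ U).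
  by apply: ultra_cvg; exists 1 => n; exact: sin_max.
move: cc cs.
set C := fun t : R => (lim ((fun n : nat => cos (t * n%:R)) @ U) : R).
set S := fun t : R => (lim ((fun n : nat => sin (t * n%:R)) @ U) : R) => cc cs.
pose D (n : nat) (t : R) : R :=
  (cos (t * n%:R) - C t) * (cos (t * n%:R) - C t) +
  (sin (t * n%:R) - S t) * (sin (t * n%:R) - S t).
have D0 : (fun n => \sum_(t <- F) D n t) @ U --> 0.
  have z : \sum_(t <- F) (0 : R) = 0 by rewrite big1.
  rewrite -[X in _ --> X]z.
  apply: cvg_sumr => t.
  have -> : (0 : R) = (C t - C t) * (C t - C t) + (S t - S t) * (S t - S t).
    by rewrite !subrr mulr0 addr0.
  have hc : (fun n : nat => cos (t * n%:R) - C t) @ U --> C t - C t.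
    by apply: cvgB; [exact: cc|exact: cvg_cst].
  have hs : (fun n : nat => sin (t * n%:R) - S t) @ U --> S t - S t.
    by apply: cvgB; [exact: cs|exact: cvg_cst].
  exact: (cvgD (cvgM hc hc) (cvgM hs hs)).
have e0 : 0 < rho / 3 by rewrite divr_gt0.
have Dsmall : \forall n \near U, \sum_(t <- F) D n t <= rho / 3.
  by have /cvgr0_norm_le/(_ _ e0) := D0; apply: filterS => n /ler_normlW.
have [n1 h1] := filter_ex Dsmall.
have [n2 [h2 n12]] : exists n2, (\sum_(t <- F) D n2 t <= rho / 3) /\ (n1 < n2)%N.
  apply: (@filter_ex _ U); apply: filterI => //.
  by apply: hU; exists n1.+1.
exists (n2 - n1)%N; rewrite ?subn_gt0// /bohr_nbhs /=.
apply: (@le_lt_trans _ _ (\sum_(t <- F) (D n1 t + D n2 t))); last first.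
  by rewrite big_split /=; lra.
(* [1 - cos] of the difference is half the squared distance of two unit vectors; by the
   parallelogram law it is at most the sum of their squared distances to the limit. *)
apply: ler_sum => t _; rewrite -pmulrn natrB ?(ltnW n12)// mulrBr cosB /D.
have := cos2Dsin2 (t * n1%:R); have := cos2Dsin2 (t * n2%:R).
set c1 := cos _; set s1 := sin _; set c2 := cos _; set s2 := sin _.
have := sqr_ge0 (c1 + c2 - 2 * C t); have := sqr_ge0 (s1 + s2 - 2 * S t); nra.
Qed.

End BohrSets.

Section Density.
Context {R : realType}.

Lemma limn_sup_frequently (u : nat -> R) (e : R) J : bdd u -> 0 < e ->
  exists2 j, (J <= j)%N & limn_sup u - e < u j.
Proof.
move=> [C hC] e0.
have bu : bounded_fun u.
  by exists C; split; [exact: num_real|] => x Cx y _ /=; apply: (le_trans (hC y)); exact: ltW.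
have hs : has_sup (sdrop u J).
  split; first by exists (u J), J => /=.
  by exists C => _ [n _ <-]; apply: le_trans (hC n); exact: ler_norm.
have [_ [j Jj <-] hj] := sup_adherent e0 hs.
exists j => //; apply: le_lt_trans hj; rewrite lerD2r limn_supE//.
apply: ge_inf; first exact: bounded_fun_has_lbound_sups.
by exists J.
Qed.

End Density.

(** * The mean ergodic estimate *)

Section MeanOfConvolution.
Context {R : realType}.
Variables (L : (int -> R) -> R) (B : set int).
Hypothesis mL : is_mean L.
Local Notation b := (\1_B : int -> R).
Local Notation beta := (L b).
Let bb : bdd b := bdd_indic B.

Lemma mean_ge0 f : bdd f -> (forall x, 0 <= f x) -> 0 <= L f.
Proof.
move=> bf f0; rewrite -(mean_cst mL 0); apply: (le_mean mL) => //; exact: bdd_cst.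
Qed.

Lemma correlation0_indic : correlation L b 0 = beta.
Proof.
rewrite /correlation; congr L; apply/funext => x.
by rewrite addr0 indicE; case: (_ \in _); rewrite ?mulr0 ?mulr1.
Qed.

Lemma mean_conv s : L (conv s b) = (\sum_(p <- s) p.1) * beta.
Proof.
rewrite (mean_sum mL); last first.
  by move=> p; apply: bddM; [exact: bdd_cst|exact: (bdd_comp (fun x => x - p.2) bb)].
rewrite mulr_suml; apply: eq_bigr => p _.
rewrite (meanZ mL); last exact: (bdd_comp (fun x => x - p.2) bb).
by congr (_ * _); exact: (mean_shift mL).
Qed.

Variable G : R -> R.
Hypothesis G_homo : {homo G : x y / x <= y}.
Hypothesis G_spectral : forall s, L (fun x => conv s b x ^+ 2) =
  beta * I01 (fun t => power s (G t)).
Hypothesis beta0 : 0 < beta.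
Hypothesis betaE : beta = upper_banach_density R B.

Let mG : measurable_fun setT G := nondecreasing_measurable G_homo.

Lemma cos_int_2pi (k : int) : cos (k%:~R * (pi *+ 2)) = 1 :> R.
Proof.
have h (n : nat) : cos (n%:R * (pi *+ 2)) = 1 :> R.
  by rewrite mulr_natl -[_ *+ n]add0r (periodicn (@cosD2pi R)) cos0.
case: k => n; first exact: h.
by rewrite NegzE mulrNz mulNr cosN; exact: h.
Qed.

(** The test weight is uniform on [H] consecutive integers: its [power] is 1 at 0 and [2 pi], so
    [beta] times the atom is at most the mean of a squared window average. One factor of the square
    is at most [max_window B H / H], which tends to [beta]; the other has mean [beta]. *)
Lemma spectral_atom0_le : I01 \1_(~` off G [:: 0; pi *+ 2]) <= beta.
Proof.
have key H : (0 < H)%N -> I01 \1_(~` off G [:: 0; pi *+ 2]) <= max_window B H / H%:R.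
  move=> H0; have HR : (0 : R) < H%:R by rewrite ltr0n.
  pose s : seq (R * int) := [seq (H%:R^-1, - h%:Z) | h <- index_iota 0 H].
  have ms : \sum_(p <- s) p.1 = 1.
    by rewrite big_map big_const_seq count_predT size_iota subn0 iter_addr_0 -[_ *+ H]mulr_natr mulVf// gt_eqF.
  have cs x : conv s b x = window b x H / H%:R.
    rewrite /conv big_map big_mkord /window mulr_suml.
    by apply: eq_bigr => i _; rewrite opprK mulrC.
  have pw t : G t \in [:: 0; pi *+ 2] -> power s (G t) = 1.
    have c1 k : cos (k%:~R * G t) = 1 -> sin (k%:~R * G t) = 0.
      by move=> h; apply: cos1sin0; rewrite h normr1.
    move=> Gt; have h k : cos (k%:~R * G t) = 1.
      by move: Gt; rewrite !inE => /orP[/eqP|/eqP] ->; rewrite ?mulr0 ?cos0 ?cos_int_2pi.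
    rewrite /power.
    under eq_bigr do rewrite h mulr1.
    under [X in _ + X ^+ 2]eq_bigr do rewrite c1 ?h// mulr0.
    by rewrite ms big1 // expr0n addr0 expr1n.
  have moff := measurableC (measurable_off G_homo [:: 0; pi *+ 2]).
  apply: (@le_trans _ _ (I01 (fun t => power s (G t)))).
    apply: le_I01; [exact: bdd_meas_indic|exact: bdd_meas_power|].
    move=> t _; rewrite indicE; case: (boolP (t \in _)) => [/set_mem|_]; last exact: power_ge0.
    by rewrite /off /= => /negP; rewrite negbK => /pw ->.
  have Lc : L (conv s b) = beta by rewrite mean_conv ms mul1r.
  rewrite -(ler_pM2l beta0) -G_spectral [leRHS]mulrC -[X in _ <= _ * X]Lc -(meanZ mL); last exact: bdd_conv.
  apply: (le_mean mL).
  - by under eq_fun do rewrite expr2; apply: bddM; exact: bdd_conv.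
  - by apply: bddM; [exact: bdd_cst|exact: bdd_conv].
  - move=> x; rewrite expr2 cs ler_wpM2r ?divr_ge0 ?window_indic_ge0//.
    by rewrite ler_pM2r ?invr_gt0// window_le_max.
rewrite betaE; apply: (cvgr_to_ge (@cvg_max_window R B)).
by near=> H; apply: key; near: H; exact: nbhs_infty_gt.
Unshelve. all: by end_near. Qed.

Variable W : nat -> seq (R * int).
Hypothesis G_2pi : forall s, 0 <= G s <= pi *+ 2.
Hypothesis W_weight : forall j, weight (W j).
Hypothesis W_equid : forall t, 0 < t < pi *+ 2 -> (fun j => power (W j) t) @ \oo --> 0.
Hypothesis W_mass : (fun j => \sum_(p <- W j) p.1) @ \oo --> (1 : R).

Lemma mean_indic_le1 : beta <= 1.
Proof.
by rewrite -(mean_cst mL 1); apply: (le_mean mL) => //; exact: bdd_cst.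
Qed.

(* The ergodic theorem along [W]; ergodicity is replaced by [spectral_atom0_le]. *)
Lemma mean_ergodic_near (e : R) : 0 < e ->
  \forall j \near \oo, L (fun x => (conv (W j) b x - beta) ^+ 2) <= e.
Proof.
move=> e0; have e3 : 0 < e / 3 by rewrite divr_gt0.
have n1 := power_integral_near_atom G_homo G_2pi W_weight W_equid e3.
have /cvgrPdist_le/(_ _ e3) n2 := W_mass.
near=> j.
have h1 : I01 (fun s => power (W j) (G s)) <= I01 \1_(~` off G [:: 0; pi *+ 2]) + e / 3.
  by near: j.
have h2 : `|1 - \sum_(p <- W j) p.1| <= e / 3 by near: j.
have -> : (fun x => (conv (W j) b x - beta) ^+ 2) =
    (fun x => conv (W j) b x ^+ 2 + ((- (2 * beta)) * conv (W j) b x + beta ^+ 2)).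
  by apply/funext => x; ring.
have bc := bdd_conv (W j) bb.
have bc2 : bdd (fun x => conv (W j) b x ^+ 2) by under eq_fun do rewrite expr2; exact: bddM.
have bc3 : bdd (fun x => - (2 * beta) * conv (W j) b x) by apply: bddM => //; exact: bdd_cst.
rewrite (meanD mL)//; last by apply: bddD => //; exact: bdd_cst.
rewrite (meanD mL)//; last exact: bdd_cst.
rewrite (meanZ mL)// mean_conv (mean_cst mL) G_spectral.
have := spectral_atom0_le; have := mean_indic_le1.
move: h2; rewrite ler_norml => /andP[_ h2].
move: h1 h2 beta0; set I := I01 _; set J := I01 _; set m := \sum_(_ <- _) _.
move=> h1 h2 b0 b1 Jb; move: beta b0 b1 Jb => c c0 c1 Jc.
(* The mean is [c * I - 2 * c ^+ 2 * m + c ^+ 2]. The integral costs [e / 3]; the missing mass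
   [1 - m] enters twice and costs [2 * e / 3]. *)
have i1 : c * I <= c * (c + e / 3) by rewrite ler_wpM2l ?(ltW c0)//; lra.
have i2 : c * (e / 3) <= e / 3 by rewrite ler_piMl// ltW.
have i3 : c ^+ 2 * (1 - m) <= c ^+ 2 * (e / 3) by rewrite ler_wpM2l ?sqr_ge0//; lra.
have i4 : c ^+ 2 * (e / 3) <= e / 3 by rewrite ler_piMl ?(ltW e3)// expr_le1// ltW.
lra.
Unshelve. all: by end_near. Qed.

End MeanOfConvolution.

Section AlmostPeriods.
Context {R : realType}.
Variables (L : (int -> R) -> R) (B : set int) (G : R -> R).
Hypothesis mL : is_mean L.
Hypothesis G_homo : {homo G : x y / x <= y}.
Hypothesis G_spectral : forall s, L (fun x => conv s \1_B x ^+ 2) =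
  L \1_B * I01 (fun t => power s (G t)).

(** The factor [2 - 2 cos] is at most [rho] at frequencies in [F], where [power] is at most 1, and
    at most 4 elsewhere. *)
Lemma mean_translation_le (F : seq R) s d (rho : R) : weight s -> 0 <= rho ->
  (forall t, t \in F -> 2 - 2 * cos (d%:~R * t) <= rho) ->
  L (fun x => (conv s \1_B (x + d) - conv s \1_B x) ^+ 2) <=
    rho + 4 * I01 (fun t => \1_(off G F) t * power s (G t)).
Proof.
move=> ws rho0 hF.
have mG := nondecreasing_measurable G_homo.
have b0 : 0 <= L \1_B by apply: (mean_ge0 mL); [exact: bdd_indic|move=> x; rewrite indicE].
have b1 := @mean_indic_le1 R L B mL.
have bo : bdd_meas (fun t => \1_(off G F) t * power s (G t)).
  by apply: bdd_measM; [apply: bdd_meas_indic; exact: measurable_off|exact: bdd_meas_power].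
under eq_fun do rewrite -conv_translation_diff.
rewrite G_spectral.
have I0 : 0 <= I01 (fun t => power (translation_diff d s) (G t)).
  rewrite -(I01_cst 0); apply: le_I01; [exact: bdd_meas_cst|exact: bdd_meas_power|].
  by move=> t _; exact: power_ge0.
apply: (@le_trans _ _ (I01 (fun t => power (translation_diff d s) (G t)))).
  by rewrite ler_piMl.
apply: (@le_trans _ _ (I01 (fun t => rho + 4 * (\1_(off G F) t * power s (G t))))).
  apply: le_I01; [exact: bdd_meas_power|by apply: bdd_measD; [exact: bdd_meas_cst|exact: bdd_measZ]|].
  move=> t _; rewrite power_translation_diff indicE.
  have p0 := power_ge0 s (G t); have p1 := power_le1 (G t) ws.
  have c1 := cos_geN1 (d%:~R * G t); have c2 := cos_le1 (d%:~R * G t).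
  case: (boolP (t \in off G F)) => [_|/negP tF] /=.
    by rewrite mul1r; nra.
  rewrite mul0r mulr0 addr0.
  have : G t \in F by apply: contrapT => /negP h; apply: tF; exact: mem_set.
  by move=> /hF h; nra.
by rewrite I01D ?I01Z ?I01_cst//; [exact: bdd_meas_cst|exact: bdd_measZ].
Qed.

End AlmostPeriods.

(** * Superlevel sets and the conclusion *)

Section Main.
Context {R : realType}.

Lemma conv_eq0 (s : seq (R * int)) (A B : set int) x :
  (forall p, p \in s -> p.2 \in A) -> ~ sumset A B x -> conv s \1_B x = 0.
Proof.
move=> sA nx; rewrite /conv big_seq big1// => p ps.
rewrite indicE memNset ?mulr0// => Bx; apply: nx.
exists p.2; first by have /set_mem := sA p ps.
by exists (x - p.2) => //; ring.
Qed.

(** If [f x > delta] but some [x + l * d] lies outside [S], then [f] vanishes there and the [l]-th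
    squared difference exceeds [delta ^+ 2]; such points are charged to the sum. *)
Lemma mean_bigcap_shift_ge (L : (int -> R) -> R) (f : int -> R) (k : nat) (d : int) (delta : R)
    (S : set int) :
  is_mean L -> bdd f -> 0 < delta -> (forall x, ~ S x -> f x = 0) ->
  L \1_[set x | delta < f x] -
    (\sum_(l < k.+1) L (fun x => (f (x + l%:Z * d) - f x) ^+ 2)) / delta ^+ 2 <=
  L \1_(\bigcap_(l < k.+1) shift_left S (l%:Z * d)).
Proof.
move=> mL bf d0 fS; have dd : 0 < delta ^+ 2 by rewrite exprn_gt0.
have bq l : bdd (fun x => (f (x + l%:Z * d) - f x) ^+ 2).
  by apply: bdd_sqr; apply: bddB => //; exact: (bdd_comp (fun x => x + l%:Z * d) bf).
have bq' l : bdd (fun x => (delta ^+ 2)^-1 * (f (x + l%:Z * d) - f x) ^+ 2).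
  by apply: bddM => //; exact: bdd_cst.
set E := mkset _; set T := \bigcap_(_ in _) _.
rewrite lerBlDr mulrC mulr_sumr.
under [X in _ + X]eq_bigr do rewrite -(meanZ mL)//.
rewrite -(mean_sum mL)// -(meanD mL); [|exact: bdd_indic|exact: bdd_sum].
apply: (le_mean mL); [exact: bdd_indic|by apply: bddD; [exact: bdd_indic|exact: bdd_sum]|].
move=> x; have sum0 (P : pred 'I_k.+1) :
    0 <= \sum_(l < k.+1 | P l) (delta ^+ 2)^-1 * (f (x + l%:Z * d) - f x) ^+ 2.
  by apply: sumr_ge0 => l _; rewrite mulr_ge0 ?sqr_ge0// invr_ge0 ltW.
rewrite !indicE; case: (pselect (E x)) => xE; last first.
  by rewrite memNset// addr_ge0.
rewrite (mem_set xE); case: (pselect (T x)) => xT; first by rewrite mem_set// lerDl.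
rewrite memNset// add0r /=.
have [l lk nl] : exists2 l : nat, (l < k.+1)%N & ~ S (x + l%:Z * d).
  apply: contrapT => h; apply: xT => l /= lk.
  exists (x + l%:Z * d); last by rewrite addrK.
  by apply: contrapT => nS; apply: h; exists l.
rewrite (bigD1 (Ordinal lk)) //= (fS _ nl) sub0r sqrrN.
apply: (@le_trans _ _ ((delta ^+ 2)^-1 * f x ^+ 2)); last by rewrite lerDl.
rewrite mulrC ler_pdivlMr// mul1r ler_sqr ?nnegrE ?(ltW d0)//; first exact: ltW.
by rewrite (le_trans (ltW d0))// ltW.
Qed.

(** On the superlevel set [f] is bounded by [a] in one estimate and by [g] in the other, with
    [y <= eta + y ^+ 2 / eta] for [y = g x - beta]. Each estimate yields one of the two
    densities. *)
Lemma superlevel_mean_ge (L : (int -> R) -> R) (f g : int -> R) (a beta delta eta : R) :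
  is_mean L -> bdd f -> bdd g -> 0 < delta -> 0 < eta -> 0 <= beta ->
  (forall x, 0 <= f x <= a) -> (forall x, f x <= g x) ->
  L f <= delta + a * L \1_[set x | delta < f x] /\
  L f <= delta + beta * L \1_[set x | delta < f x] +
    (eta + L (fun x => (g x - beta) ^+ 2) / eta).
Proof.
move=> mL bf bg d0 e0 b0 fa fg; set E := mkset _.
have bE := bdd_indic (R := R) E.
have bEc (c : R) : bdd (fun x => c * \1_E x) := bddM (bdd_cst c) bE.
have bcst (c : R) : bdd (fun _ : int => c) by exact: bdd_cst.
have bg2 : bdd (fun x => (g x - beta) ^+ 2) by apply: bdd_sqr; exact: bddB.
have bg2' : bdd (fun x => eta^-1 * (g x - beta) ^+ 2) by exact: bddM.
have fE x : f x <= delta + f x * \1_E x.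
  rewrite indicE; case: (pselect (E x)) => xE; first by rewrite mem_set// mulr1 lerDr ltW.
  by rewrite memNset// mulr0 addr0 leNgt; exact/negP.
have E01 x : 0 <= (\1_E x : R) <= 1 by rewrite indicE ler0n lern1 leq_b1.
split.
  rewrite -{1}(mean_cst mL delta) -(meanZ mL)// -(meanD mL)//.
  apply: (le_mean mL) => //; first exact: bddD.
  move=> x; apply: (le_trans (fE x)); rewrite lerD2l.
  have /andP[i0 _] := E01 x; have /andP[_ fxa] := fa x; exact: ler_wpM2r.
rewrite -{1}(mean_cst mL delta) -{1}(mean_cst mL eta) [X in _ + (_ + X)]mulrC.
rewrite -!(meanZ mL)// -!(meanD mL)//; [|exact: bddD|exact: bddD].
apply: (le_mean mL) => //; first by apply: bddD; exact: bddD.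
move=> x; apply: (le_trans (fE x)); rewrite -addrA lerD2l.
apply: (@le_trans _ _ (g x * \1_E x)).
  by have /andP[i0 _] := E01 x; exact: ler_wpM2r.
have yb : g x - beta <= eta + eta^-1 * (g x - beta) ^+ 2.
  set y := g x - beta; rewrite -(ler_pM2r e0).
  have -> : (eta + eta^-1 * y ^+ 2) * eta = eta ^+ 2 + y ^+ 2 by field; rewrite gt_eqF.
  by have := sqr_ge0 (y - eta); nra.
have n0 : 0 <= eta + eta^-1 * (g x - beta) ^+ 2.
  by rewrite addr_ge0 ?(ltW e0)// mulr_ge0 ?sqr_ge0// invr_ge0 ltW.
move: yb n0 (E01 x); set z := eta + _ => yb n0 /andP[i0 i1]; nra.
Qed.

End Main.

Theorem theorem1p6 (R : realType) (nu : nat -> probability int R)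
    (A B : set int) :
  equidistributed nu ->
  0 < upper_density nu A ->
  0 < upper_banach_density R B ->
  forall (k : nat) (eps : R), (0 < k)%N -> 0 < eps ->
    (exists d : nat, (0 < d)%N /\
      Num.max (upper_density nu A) (upper_banach_density R B) - eps
        < upper_banach_density R
            (\bigcap_(l < k.+1) shift_left (sumset A B) (l%:Z * d%:Z))) /\
    (exists D : set int, is_bohr R D /\
      forall d : int, D d ->
        Num.max (upper_density nu A) (upper_banach_density R B) - eps
          < upper_banach_density R
              (\bigcap_(l < k.+1) shift_left (sumset A B) (l%:Z * d))).
Proof.
move=> eq_nu; set alpha := upper_density nu A; set beta := upper_banach_density R B.
move=> alpha0 beta0 k eps _ eps0.
(* A Bohr neighbourhood of 0 serves both claims: it is a Bohr set and contains a positive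
   integer. *)
suff [F [rho [rho0 hD]]] : exists (F : seq R) (rho : R), 0 < rho /\
    forall d : int, bohr_nbhs F rho d -> Num.max alpha beta - eps
      < upper_banach_density R (\bigcap_(l < k.+1) shift_left (sumset A B) (l%:Z * d)).
  split; last by exists (bohr_nbhs F rho); split => //; exact: bohr_nbhs_is_bohr.
  have [d d0 dD] := bohr_nbhs_recurrent F rho0.
  by exists d; split => //; exact: hD.
have [L [mL LB Ld]] := exists_mean (R := R) B.
have bB := bdd_indic (R := R) B.
have c0 : correlation L \1_B 0 = beta by rewrite correlation0_indic.
have [|G [nG G2 GL]] := spectral_measure mL bB; first by rewrite c0.
rewrite c0 /beta -LB in GL.
have [W [wW eW mW AW]] := equidistributed_truncation eq_nu.
(* [delta] is the superlevel at which the convolution is cut, [rho] the allowed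
   translation error, and [N.+1%:R^-1] bounds the mass of atoms outside the grid. *)
pose delta := eps * Num.min alpha beta / 8.
have m0 : 0 < Num.min alpha beta by rewrite lt_min alpha0.
have delta0 : 0 < delta by rewrite divr_gt0// mulr_gt0.
have deltaA : 8 * delta <= eps * alpha.
  by rewrite mulrC divfK// ler_pM2l// ge_min lexx.
have deltaB : 8 * delta <= eps * beta.
  by rewrite mulrC divfK// ler_pM2l// ge_min lexx orbT.
have k1 : (0 : R) < k.+1%:R by rewrite ltr0n.
(* Each of the [k + 1] translates will cost [2 * rho], so division by [delta ^+ 2] leaves [eps / 4]
   in total. *)
pose rho := eps * delta ^+ 2 / (8 * k.+1%:R).
have rho0 : 0 < rho by rewrite divr_gt0// mulr_gt0// exprn_gt0.
(* With [tau = rho / 8] and [kappa = 1 / (N + 1)], the bound [tau + 2 * kappa / tau] is at most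
   [rho / 4] as soon as [kappa <= rho ^+ 2 / 128]. *)
have [N hN] : exists N : nat, N.+1%:R^-1 <= rho ^+ 2 / 128.
  have x0 : 0 < rho ^+ 2 / 128 by rewrite divr_gt0// exprn_gt0.
  exists (Num.truncn (rho ^+ 2 / 128)^-1).
  by rewrite invf_ple ?posrE ?ltr0n//; exact/ltW/truncnS_gt.
pose F := level_grid G N.+1.
have rho8 : 0 < rho / 8 by rewrite divr_gt0.
have N1 : (0 : R) < N.+1%:R^-1 by rewrite invr_gt0.
have near_off := power_filter_off_near nG G2 wW eW
  (mem_head 0 _ : 0 \in F) (_ : pi *+ 2 \in F) N1
  (fun s s01 sF => level_grid_le nG (ltn0Sn N) s01 sF) rho8.
have {near_off} near_off : \forall j \near \oo, forall P : pred (R * int),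
    I01 (fun s => \1_(off G F) s * power (seq.filter P (W j)) (G s)) <= rho / 4.
  have : pi *+ 2 \in F by rewrite !in_cons eqxx orbT.
  move=> /near_off; apply: filterS => j h P; apply: (le_trans (h P)).
  have : N.+1%:R^-1 *+ 2 / (rho / 8) <= rho / 8.
    rewrite ler_pdivrMr// -[_ *+ 2]mulr_natr.
    by rewrite -ler_pdivlMr//; apply: (le_trans hN); nra.
  have -> : rho / 4 = rho / 8 + rho / 8 by field.
  by rewrite lerD2l.
pose eta := beta * eps / 8.
have eta0 : 0 < eta by rewrite divr_gt0// mulr_gt0.
have LB0 : 0 < L \1_B by rewrite LB.
have near_erg := mean_ergodic_near mL nG GL LB0 LB G2 wW eW mW (exprn_gt0 2 eta0).
(* The first entry keeps the mass [a] above [alpha / 2], as needed to divide by it; the second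
   limits the loss in [alpha]. Half of [xi] goes to the limit superior and half to the
   truncation. *)
pose xi := Num.min (alpha / 2) (eps / 8).
have xi0 : 0 < xi by rewrite lt_min !divr_gt0.
have near_inv : \forall j \near \oo, j.+1%:R^-1 <= xi / 2.
  have x2 : 0 < xi / 2 by rewrite divr_gt0.
  have /cvgr0_norm_le/(_ _ x2) := @cvg_harmonic R.
  by apply: filterS => j /ler_normlW.
have [J _ hJ] : \forall j \near \oo, [/\ forall P : pred (R * int),
    I01 (fun s => \1_(off G F) s * power (seq.filter P (W j)) (G s)) <= rho / 4,
    L (fun x => (conv (W j) \1_B x - L \1_B) ^+ 2) <= eta ^+ 2 &
    j.+1%:R^-1 <= xi / 2].
  by near=> j; split; near: j.
have nu1 : bdd (fun j => fine (nu j A)).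
  exists 1 => j; rewrite ger0_norm ?fine_ge0// -[leRHS]/(fine 1%E).
  by rewrite fine_le ?fin_num_measure// probability_le1.
have xi2 : 0 < xi / 2 by rewrite divr_gt0.
(* The smallness conditions hold for all [j >= J], whereas mass close to [alpha] on [A] occurs only
   for arbitrarily large [j]. *)
have [j Jj hj] := limn_sup_frequently J nu1 xi2.
have [{hJ} h_off h_erg h_inv] := hJ j Jj.
pose V := [seq p <- W j | p.2 \in A].
have wV : weight V by exact: weight_filter.
pose a := \sum_(p <- V) p.1.
have aE : a = \sum_(p <- W j | p.2 \in A) p.1 by rewrite /a big_filter.
have a_ge : alpha - xi <= a.
  rewrite aE; apply: le_trans (AW A j).
  have -> : alpha - xi = (alpha - xi / 2) - xi / 2 by field.
  by apply: lerB => //; exact: ltW.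
(* The multiples [l * t] make all of [d, ..., k * d] almost periods for the frequencies in [F];
   radius [rho / 2] turns into [2 - 2 cos <= rho]. *)
exists [seq l%:R * t | l <- iota 0 k.+1, t <- F], (rho / 2).
split; first by rewrite divr_gt0.
move=> d dD.
have b01 x : 0 <= (\1_B x : R) <= 1 by rewrite indicE ler0n lern1 leq_b1.
have V0 p : p \in V -> 0 <= p.1 by exact: wV.1.
have fa x : 0 <= conv V \1_B x <= a.
  rewrite /conv /a; apply/andP; split; rewrite big_seq.
    apply: sumr_ge0 => p pV; have /andP[i0 _] := b01 (x - p.2).
    by rewrite mulr_ge0 ?V0.
  rewrite [leRHS]big_seq; apply: ler_sum => p pV; have /andP[_ i1] := b01 (x - p.2).
  by rewrite ler_piMr ?V0.
have fg x : conv V \1_B x <= conv (W j) \1_B x.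
  rewrite /conv big_filter big_mkcond big_seq [leRHS]big_seq; apply: ler_sum => p pW.
  case: ifP => // _; have /andP[i0 _] := b01 (x - p.2).
  by rewrite mulr_ge0// (wW j).1.
have bV := bdd_conv V bB.
have VS x : ~ sumset A B x -> conv V \1_B x = 0.
  by apply: conv_eq0 => p; rewrite mem_filter => /andP[].
have [] := superlevel_mean_ge mL bV (bdd_conv (W j) bB) delta0 eta0 (ltW LB0) fa fg.
rewrite (mean_conv _ mL) -/a LB -/beta; set X := L \1_(mkset _) => X1 X2.
have {}X2 : a * beta <= delta + beta * X + 2 * eta.
  apply: (le_trans X2); rewrite lerD2l mulr2n mulrDl mul1r lerD2l.
  by rewrite ler_pdivrMr// -expr2 /beta -LB.
have X3 := mean_bigcap_shift_ge k d mL bV delta0 VS.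
have trans l : (l < k.+1)%N ->
    L (fun x => (conv V \1_B (x + l%:Z * d) - conv V \1_B x) ^+ 2) <= 2 * rho.
  move=> lk.
  have h t : t \in F -> 2 - 2 * cos ((l%:Z * d)%:~R * t) <= rho.
    move=> tF; have nn (u : R) : 0 <= 1 - cos (u * d%:~R) by rewrite subr_ge0 cos_le1.
    have : 1 - cos (l%:R * t * d%:~R) <= rho / 2.
      apply: le_trans (ltW dD).
      have : l%:R * t \in [seq l%:R * t | l <- iota 0 k.+1, t <- F].
        by apply/allpairsP; exists (l, t); rewrite mem_iota.
      move=> /perm_to_rem/(perm_big _) /= ->.
      by rewrite big_cons lerDl sumr_ge0.
    by rewrite intrM -pmulrn mulrAC; lra.
  have := mean_translation_le mL nG GL wV (ltW rho0) h.
  move=> /le_trans; apply; have := h_off (fun p => p.2 \in A); rewrite -/V; lra.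
have sum_le : (\sum_(l < k.+1) L (fun x => (conv V \1_B (x + l%:Z * d) - conv V \1_B x) ^+ 2))
    / delta ^+ 2 <= eps / 4.
  rewrite ler_pdivrMr ?exprn_gt0//.
  apply: (@le_trans _ _ (\sum_(l < k.+1) 2 * rho)).
    by apply: ler_sum => l _; exact: trans.
  rewrite sumr_const card_ord -[_ *+ k.+1]mulr_natr /rho.
  have -> : 2 * (eps * delta ^+ 2 / (8 * k.+1%:R)) * k.+1%:R = eps / 4 * delta ^+ 2.
    by field; rewrite gt_eqF.
  exact: lexx.
apply: lt_le_trans (Ld _); apply: lt_le_trans X3.
rewrite -/X; apply: (@lt_le_trans _ _ (X - eps / 4)); last by rewrite lerD2l lerN2.
have xi1 : xi <= alpha / 2 by rewrite ge_min lexx.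
have xi3 : xi <= eps / 8 by rewrite ge_min lexx orbT.
(* Otherwise [a * eps / 4 < a * (beta - X) <= delta], whereas
   [delta <= eps * alpha / 8 <= a * eps / 4]. *)
have Xbeta : beta - eps / 4 <= X.
  have a1 : alpha / 2 <= a by lra.
  rewrite leNgt; apply/negP => h.
  have : a * (eps / 4) < a * (beta - X) by rewrite ltr_pM2l; lra.
  have : alpha / 2 * (eps / 4) <= a * (eps / 4) by rewrite ler_wpM2r//; lra.
  lra.
(* After division by [beta], the terms [delta] and [2 * eta] cost [eps / 8] and [eps / 4]; replacing
   [a] by [alpha] costs another [eps / 8]. *)
have Xalpha : alpha - eps / 2 <= X.
  have : beta * (a - X) <= beta * (3 / 8 * eps) by rewrite /eta in X2; lra.
  by rewrite ler_pM2l//; lra.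
by rewrite ltrBDr maxEle; case: ifP => _; lra.
Unshelve. all: by end_near. Qed.
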